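(* Let $\mathbb{A}\in\{\mathbb{R},\mathbb{C},\mathbb{H},\mathbb{O}\}$ and let $n\ge 1$, with $n=1$ when $\mathbb{A}=\mathbb{O}$. Let $G_{\mathbb{A}}(n)$ be the group of twisted isomorphisms of $\mathbb{A}^n$. Then $$G_{\mathbb{R}}(n)=O(n),\qquad G_{\mathbb{C}}(n)=U(n),\qquad G_{\mathbb{H}}(n)=Sp(n)Sp(1),\qquad G_{\mathbb{O}}(1)=Spin(7).$$
   Context: $\mathbb{R},\mathbb{C},\mathbb{H},\mathbb{O}$ are the four normed division algebras (reals, complex numbers, quaternions, octonions) with their standard norm and inner product $\langle x,y\rangle=\mathrm{Re}(x\bar y)$. The space $\mathbb{A}^n$ (with $n=1$ if $\mathbb{A}=\mathbb{O}$) carries the standard Euclidean inner product and componentwise right multiplication by elements of $\mathbb{A}$. $SO(\mathbb{A})$ is the special orthogonal group of $\mathbb{A}$ viewed as a real inner product space. A twisted isomorphism of $\mathbb{A}^n$ is an $\mathbb{R}$-linear isometry $\phi$ of $\mathbb{A}^n$ such that there exists $\theta\in SO(\mathbb{A})$ with $\phi(vx)=\phi(v)\theta(x)$ for all $v\in\mathbb{A}^n$, $x\in\mathbb{A}$. All groups are viewed as subgroups of $O(n\dim_{\mathbb{R}}\mathbb{A})$: $U(n)$ is the group of $\mathbb{C}$-linear isometries of $\mathbb{C}^n$; $Sp(n)$ is the group of right $\mathbb{H}$-linear isometries of $\mathbb{H}^n$, and $Sp(n)Sp(1)$ is the group of maps $v\mapsto \alpha(v)\beta$ with $\alpha\in Sp(n)$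 and $\beta\in\mathbb{H}$, $|\beta|=1$; $Spin(7)\subset SO(8)$ is embedded by its $8$-dimensional real spin representation on $\mathbb{O}\cong\mathbb{R}^8$. *)

(* Defs.v *)
From HB Require Import structures.
From mathcomp Require Import all_boot all_order all_algebra.
From mathcomp Require Import boolp classical_sets reals.
From mathcomp Require Import complex ring lra.

Set Implicit Arguments.
Unset Strict Implicit.
Unset Printing Implicit Defensive.

Import Order.TTheory GRing.Theory Num.Theory.

Local Open Scope ring_scope.

Record normed_div_alg_laws (R : realType) (V : vectType R) (mul : V -> V -> V)
    (one : V) (conj : V -> V) (re : V -> R) : Prop := NormedDivAlgLaws {
  ndl_mulDl : left_distributive mul +%R;
  ndl_mulDr : right_distributive mul +%R;
  ndl_scaleAl : forall (a : R) x y, a *: mul x y = mul (a *: x) y;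
  ndl_scaleAr : forall (a : R) x y, a *: mul x y = mul x (a *: y);
  ndl_mul1l : left_id one mul;
  ndl_mul1r : right_id one mul;
  ndl_reP : forall (a : R) x y, re (a *: x + y) = a * re x + re y;
  ndl_conjE : forall x, x + conj x = (2 * re x) *: one;
  ndl_norm_ge0 : forall x, 0 <= re (mul x (conj x));
  ndl_norm_eq0 : forall x, re (mul x (conj x)) = 0 -> x = 0;
  ndl_normM : forall x y, re (mul (mul x y) (conj (mul x y))) =
    re (mul x (conj x)) * re (mul y (conj y)) }.

(* Multiplication is not assumed to be associative. *)
Record normedDivAlg (R : realType) := NormedDivAlg {
  nda_sort :> vectType R;
  nda_mul : nda_sort -> nda_sort -> nda_sort;
  nda_one : nda_sort;
  nda_conj : nda_sort -> nda_sort;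
  nda_re : nda_sort -> R;
  nda_laws : normed_div_alg_laws nda_mul nda_one nda_conj nda_re }.

Arguments nda_one {R} n.

Section Algebra.
Context {R : realType} {A : normedDivAlg R}.

Definition nda_inner (x y : A) : R := nda_re (nda_mul x (nda_conj y)).

Definition nda_norm (x : A) : R := Num.sqrt (nda_inner x x).

End Algebra.

Section Instances.
Variable R : realType.

Lemma real_laws : @normed_div_alg_laws R R^o
  (fun x y : R => x * y) 1 id id.
Proof.
split => //=.
- exact: mulrDl.
- exact: mulrDr.
- by move=> a x y; rewrite /GRing.scale /= mulrA.
- by move=> a x y; rewrite /GRing.scale /= mulrCA.
- exact: mul1r.
- exact: mulr1.
- by move=> x; rewrite /GRing.scale /= mulr1; ring.
- by move=> x; rewrite -expr2 sqr_ge0.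
- by move=> x /eqP; rewrite mulf_eq0 orbb => /eqP.
- by move=> x y; ring.
Qed.

Definition real_alg : normedDivAlg R := NormedDivAlg real_laws.

Fact Rcomplex_vect_iso : Vector.axiom 2 (Rcomplex R).
Proof.
pose f (z : Rcomplex R) : 'rV[R]_2 :=
  \row_j (if j == 0 then complex.Re z else complex.Im z).
pose g (v : 'rV[R]_2) : Rcomplex R := Complex (v 0 0) (v 0 1).
exists f.
  move=> a [x1 x2] [y1 y2]; apply/rowP => j; rewrite !mxE.
  by case: (j == 0).
exists g; first by case=> x y; rewrite /f /g !mxE.
move=> v; apply/rowP => j; rewrite mxE /g /=.
case: j => [[|[|j]] Hj] //=; congr (v _ _); exact: val_inj.
Qed.
HB.instance Definition _ :=
  Lmodule_hasFinDim.Build R (Rcomplex R) Rcomplex_vect_iso.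

(* [Rcomplex R] is [R[i]] seen as a real vector space. *)
Lemma complex_laws : @normed_div_alg_laws R (Rcomplex R)
  (fun x y : Rcomplex R => x * y) 1
  (@conjc R) (@complex.Re R).
Proof.
split.
- exact: mulrDl.
- exact: mulrDr.
- exact: scalerAl.
- by move=> a [x1 x2] [y1 y2]; apply/eqP; rewrite eq_complex /=;
    apply/andP; split; apply/eqP; ring.
- exact: mul1r.
- exact: mulr1.
- by move=> a [x1 x2] [y1 y2].
- by move=> [x1 x2]; apply/eqP; rewrite eq_complex /=;
    apply/andP; split; apply/eqP; ring.
- by move=> [x1 x2] /=; nra.
- move=> [x1 x2] /= h; apply/eqP; rewrite eq_complex /=.
  by apply/andP; split; apply/eqP; nra.
- by move=> [x1 x2] [y1 y2] /=; ring.
Qed.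

Definition complex_alg : normedDivAlg R := NormedDivAlg complex_laws.

End Instances.

(* Cayley-Dickson doubling.  With (a, b) read as a + b j, the double of the
   complex numbers has i j = k, and the octonions double the quaternions. *)
Section CayleyDickson.
Context {R : realType} (A : normedDivAlg R).

Definition cd_mul (x y : (A * A)%type) : (A * A)%type :=
  (nda_mul x.1 y.1 - nda_mul (nda_conj y.2) x.2,
   nda_mul y.2 x.1 + nda_mul x.2 (nda_conj y.1)).

Definition cd_one : (A * A)%type := (nda_one A, 0).

Definition cd_conj (x : (A * A)%type) : (A * A)%type := (nda_conj x.1, - x.2).

Definition cd_re (x : (A * A)%type) : R := nda_re x.1.

Local Notation N a := (nda_re (nda_mul a (nda_conj a))).

Lemma cd_normM
    (mulA : forall x y z : A, nda_mul x (nda_mul y z) = nda_mul (nda_mul x y) z)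
    (conjM : forall x y : A,
      nda_conj (nda_mul x y) = nda_mul (nda_conj y) (nda_conj x))
    (conjK : forall x : A, nda_conj (nda_conj x) = x)
    (reC : forall x y : A, nda_re (nda_mul x y) = nda_re (nda_mul y x))
    (normD : forall x y : A,
      N (x + y) = N x + N y + 2 * nda_re (nda_mul x (nda_conj y)))
    (normN : forall x : A, N (- x) = N x)
    (reN : forall x y : A,
      nda_re (nda_mul x (nda_conj (- y))) = - nda_re (nda_mul x (nda_conj y)))
    (normE : forall x, cd_re (cd_mul x (cd_conj x)) = N x.1 + N x.2)
    (x y : (A * A)%type) :
  cd_re (cd_mul (cd_mul x y) (cd_conj (cd_mul x y))) =
  cd_re (cd_mul x (cd_conj x)) * cd_re (cd_mul y (cd_conj y)).
Proof.
have normC (a : A) : N (nda_conj a) = N a by rewrite conjK reC.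
case: x y => [a b] [c d]; rewrite !normE /= !normD normN reN.
have -> : nda_re (nda_mul (nda_mul d a) (nda_conj (nda_mul b (nda_conj c)))) =
          nda_re (nda_mul (nda_mul a c) (nda_conj (nda_mul (nda_conj d) b))).
  by rewrite !conjM !conjK -!mulA reC -!mulA.
by rewrite !(ndl_normM (nda_laws A)) !normC; ring.
Qed.

End CayleyDickson.

Section QuaternionsOctonions.
Variable R : realType.

Local Ltac cd_eq :=
  do ?[congr (_, _)]; apply/eqP; rewrite eq_complex; apply/andP;
  split; apply/eqP => /=; ring.

Local Notation C := (complex_alg R).

Lemma quaternion_laws : @normed_div_alg_laws R (C * C)%type
  (@cd_mul R C) (cd_one C)
  (@cd_conj R C) (@cd_re R C).
Proof.
split.
- by move=> [[x1 x2] [x3 x4]] [[y1 y2] [y3 y4]] [[z1 z2] [z3 z4]]; cd_eq.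
- by move=> [[x1 x2] [x3 x4]] [[y1 y2] [y3 y4]] [[z1 z2] [z3 z4]]; cd_eq.
- by move=> a [[x1 x2] [x3 x4]] [[y1 y2] [y3 y4]]; cd_eq.
- by move=> a [[x1 x2] [x3 x4]] [[y1 y2] [y3 y4]]; cd_eq.
- by move=> [[x1 x2] [x3 x4]]; cd_eq.
- by move=> [[x1 x2] [x3 x4]]; cd_eq.
- by move=> a [[x1 x2] [x3 x4]] [[y1 y2] [y3 y4]].
- by move=> [[x1 x2] [x3 x4]]; cd_eq.
- by move=> [[x1 x2] [x3 x4]]; rewrite /cd_re /cd_mul /=; nra.
- move=> [[x1 x2] [x3 x4]]; rewrite /cd_re /cd_mul /= => h.
  have [-> -> -> ->] : [/\ x1 = 0, x2 = 0, x3 = 0 & x4 = 0] by split; nra.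
  by [].
- by move=> [[x1 x2] [x3 x4]] [[y1 y2] [y3 y4]];
    rewrite /cd_re /cd_mul /=; ring.
Qed.

Definition quaternion_alg : normedDivAlg R := NormedDivAlg quaternion_laws.

Local Notation H := quaternion_alg.
Local Notation N a := (nda_re (nda_mul a (nda_conj a))).

Lemma quat_mulA (x y z : H) :
  nda_mul x (nda_mul y z) = nda_mul (nda_mul x y) z.
Proof.
by move: x y z => [[x1 x2] [x3 x4]] [[y1 y2] [y3 y4]] [[z1 z2] [z3 z4]]; cd_eq.
Qed.

Lemma quat_conjM (x y : H) :
  nda_conj (nda_mul x y) = nda_mul (nda_conj y) (nda_conj x).
Proof. by move: x y => [[x1 x2] [x3 x4]] [[y1 y2] [y3 y4]]; cd_eq. Qed.

Lemma quat_conjK (x : H) : nda_conj (nda_conj x) = x.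
Proof. by move: x => [[x1 x2] [x3 x4]]; cd_eq. Qed.

Lemma quat_reC (x y : H) : nda_re (nda_mul x y) = nda_re (nda_mul y x).
Proof.
by move: x y => [[x1 x2] [x3 x4]] [[y1 y2] [y3 y4]];
  rewrite /= /cd_re /cd_mul /=; ring.
Qed.

Lemma quat_normD (x y : H) :
  N (x + y) = N x + N y + 2 * nda_re (nda_mul x (nda_conj y)).
Proof.
by move: x y => [[x1 x2] [x3 x4]] [[y1 y2] [y3 y4]];
  rewrite /= /cd_re /cd_mul /=; ring.
Qed.

Lemma quat_normN (x : H) : N (- x) = N x.
Proof.
by move: x => [[x1 x2] [x3 x4]]; rewrite /= /cd_re /cd_mul /=; ring.
Qed.

Lemma quat_reN (x y : H) :
  nda_re (nda_mul x (nda_conj (- y))) = - nda_re (nda_mul x (nda_conj y)).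
Proof.
by move: x y => [[x1 x2] [x3 x4]] [[y1 y2] [y3 y4]];
  rewrite /= /cd_re /cd_mul /=; ring.
Qed.

Lemma quat_cd_norm (x : (H * H)%type) :
  cd_re (cd_mul x (cd_conj x)) = N x.1 + N x.2.
Proof.
by move: x => [[[x1 x2] [x3 x4]] [[x5 x6] [x7 x8]]];
  rewrite /cd_re /cd_mul /= /cd_re /cd_mul /=; ring.
Qed.

Lemma octonion_laws : @normed_div_alg_laws R (H * H)%type
  (@cd_mul R H) (cd_one H)
  (@cd_conj R H) (@cd_re R H).
Proof.
split.
- by move=> [[[x1 x2] [x3 x4]] [[x5 x6] [x7 x8]]] [[[y1 y2] [y3 y4]] [[y5 y6] [y7 y8]]] [[[z1 z2] [z3 z4]] [[z5 z6] [z7 z8]]]; cd_eq.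
- by move=> [[[x1 x2] [x3 x4]] [[x5 x6] [x7 x8]]] [[[y1 y2] [y3 y4]] [[y5 y6] [y7 y8]]] [[[z1 z2] [z3 z4]] [[z5 z6] [z7 z8]]]; cd_eq.
- by move=> a [[[x1 x2] [x3 x4]] [[x5 x6] [x7 x8]]] [[[y1 y2] [y3 y4]] [[y5 y6] [y7 y8]]]; cd_eq.
- by move=> a [[[x1 x2] [x3 x4]] [[x5 x6] [x7 x8]]] [[[y1 y2] [y3 y4]] [[y5 y6] [y7 y8]]]; cd_eq.
- by move=> [[[x1 x2] [x3 x4]] [[x5 x6] [x7 x8]]]; cd_eq.
- by move=> [[[x1 x2] [x3 x4]] [[x5 x6] [x7 x8]]]; cd_eq.
- by move=> a [[[x1 x2] [x3 x4]] [[x5 x6] [x7 x8]]] [[[y1 y2] [y3 y4]] [[y5 y6] [y7 y8]]].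
- by move=> [[[x1 x2] [x3 x4]] [[x5 x6] [x7 x8]]]; cd_eq.
- by move=> x; rewrite quat_cd_norm addr_ge0 // (ndl_norm_ge0 (nda_laws H)).
- move=> x; rewrite quat_cd_norm => h.
  have h1 := ndl_norm_ge0 (nda_laws H) x.1.
  have h2 := ndl_norm_ge0 (nda_laws H) x.2.
  have [z1 z2] : N x.1 = 0 /\ N x.2 = 0.
    move: h h1 h2; set u := N x.1; set v := N x.2; move: u v => u v.
    by move=> *; split; lra.
  by rewrite [x]surjective_pairing (ndl_norm_eq0 (nda_laws H) z1)
    (ndl_norm_eq0 (nda_laws H) z2).
- exact: (@cd_normM R H quat_mulA quat_conjM quat_conjK quat_reC quat_normD
    quat_normN quat_reN quat_cd_norm).
Qed.

Definition octonion_alg : normedDivAlg R := NormedDivAlg octonion_laws.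

End QuaternionsOctonions.

Section TwistedIsomorphisms.
Context {R : realType}.
Variables (A : normedDivAlg R) (n : nat).

Definition avec := {ffun 'I_n -> A}.

HB.instance Definition _ := Vector.on avec.

Definition vmul (v : avec) (x : A) : avec := [ffun i => nda_mul (v i) x].

Definition vinner (v w : avec) : R := \sum_i nda_inner (v i) (w i).

(* The orthogonal group of A^n as a real inner product space, O(n dim A). *)
Definition orthogonal : set 'End(avec) :=
  [set phi | forall v w, vinner (phi v) (phi w) = vinner v w].

Definition special_orthogonal : set 'End(A) :=
  [set theta : 'End(A) |
    (forall x y, nda_inner (theta x) (theta y) = nda_inner x y) /\
    \det (passmx.mxof (vbasis {:A}) (vbasis {:A}) theta) = 1].

Definition twisted_isomorphisms : set 'End(avec) :=
  [set phi : 'End(avec) | orthogonal phi /\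
    exists2 theta, special_orthogonal theta &
      forall v x, phi (vmul v x) = vmul (phi v) (theta x)].

Definition linear_isometries : set 'End(avec) :=
  [set phi : 'End(avec) | orthogonal phi /\
    forall v x, phi (vmul v x) = vmul (phi v) x].

Definition rmul (x : A) : 'End(avec) := linfun (vmul^~ x).

Lemma rmulE x v : rmul x v = vmul v x.
Proof.
have lin : linear (vmul^~ x).
  move=> a u w; apply/ffunP => i; rewrite !ffunE.
  by rewrite (ndl_mulDl (nda_laws A)) (ndl_scaleAl (nda_laws A)).
pose L := GRing.isLinear.Build R avec avec _ (vmul^~ x) lin.
pose f : {linear avec -> avec} := HB.pack (vmul^~ x) L.
by rewrite /rmul -/(GRing.Linear.sort f) lfunE.
Qed.

End TwistedIsomorphisms.

Arguments orthogonal {R} A n.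
Arguments special_orthogonal {R} A.
Arguments twisted_isomorphisms {R} A n.
Arguments linear_isometries {R} A n.

Definition O_group (R : realType) n := orthogonal (real_alg R) n.
Definition U_group (R : realType) n := linear_isometries (complex_alg R) n.
Definition Sp_group (R : realType) n := linear_isometries (quaternion_alg R) n.

Arguments O_group : clear implicits.
Arguments U_group : clear implicits.
Arguments Sp_group : clear implicits.

Definition SpSp1_group (R : realType) n :
    set 'End(avec (quaternion_alg R) n) :=
  [set phi : 'End(avec (quaternion_alg R) n) |
    exists2 alpha, Sp_group R n alpha &
    exists2 beta : quaternion_alg R, nda_norm beta = 1 &
      forall v, phi v = vmul (alpha v) beta].

Arguments SpSp1_group : clear implicits.

(* The Clifford algebra of R^n with v ^+ 2 = - |v| ^+ 2: the basis is indexed by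
   sets of indices, S standing for the product of the e_i, i in S, in increasing
   order, so that e_S e_T = +/- e_(S symmetric difference T). *)
Section Clifford.
Variables (R : realType) (n : nat).
Implicit Types S T U : {set 'I_n}.

Definition clifford := {ffun {set 'I_n} -> R^o}.

HB.instance Definition _ := Vector.on clifford.

Definition symdiff S T : {set 'I_n} := (S :\: T) :|: (T :\: S).

(* One sign for each transposition of distinct factors and one for each
   e_i ^+ 2 = -1. *)
Definition cl_sign S T : R := \prod_(i in S) \prod_(j in T | (j <= i)%N) (-1).

Definition cl_mul (x y : clifford) : clifford :=
  [ffun U => \sum_S \sum_(T | symdiff S T == U) cl_sign S T * (x S * y T)].

Definition cl_basis S : clifford := [ffun T => (T == S)%:R].

Lemma in_symdiff S T i : (i \in symdiff S T) = (i \in S) (+) (i \in T).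
Proof. by rewrite !inE; case: (i \in S); case: (i \in T). Qed.

Lemma symdiffA S T U : symdiff S (symdiff T U) = symdiff (symdiff S T) U.
Proof. by apply/setP => i; rewrite !in_symdiff addbA. Qed.

Lemma symdiff0s T : symdiff finset.set0 T = T.
Proof. by apply/setP => i; rewrite in_symdiff inE. Qed.

Lemma symdiffs0 T : symdiff T finset.set0 = T.
Proof. by apply/setP => i; rewrite in_symdiff inE addbF. Qed.

Lemma prod_symdiff (f : 'I_n -> R) S T : (forall i, f i * f i = 1) ->
  \prod_(i in symdiff S T) f i = \prod_(i in S) f i * \prod_(i in T) f i.
Proof.
move=> ff; rewrite big_mkcond [in RHS]big_mkcond [X in _ * X]big_mkcond.
rewrite -big_split; apply: eq_bigr => i _; rewrite in_symdiff.
by case: (i \in S); case: (i \in T); rewrite /= ?mulr1 ?mul1r ?ff.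
Qed.

Lemma cl_signDl S T U : cl_sign (symdiff S T) U = cl_sign S U * cl_sign T U.
Proof.
apply: prod_symdiff => i; rewrite -big_split big1 // => j _.
by rewrite /= mulrNN mulr1.
Qed.

Lemma cl_signDr S T U : cl_sign S (symdiff T U) = cl_sign S T * cl_sign S U.
Proof.
rewrite /cl_sign -big_split; apply: eq_bigr => i _ /=.
rewrite !big_mkcondr prod_symdiff // => j.
by case: ifP; rewrite ?mulrNN mulr1.
Qed.

Lemma cl_sign0l T : cl_sign finset.set0 T = 1.
Proof. by rewrite /cl_sign big_set0. Qed.

Lemma cl_sign0r S : cl_sign S finset.set0 = 1.
Proof.
by rewrite /cl_sign big1 // => i _; rewrite big_pred0 // => j; rewrite inE.
Qed.

Lemma cl_mulE x y :
  cl_mul x y = \sum_S \sum_T (cl_sign S T * (x S * y T)) *: cl_basis (symdiff S T).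
Proof.
apply/ffunP => U; rewrite ffunE sum_ffunE; apply: eq_bigr => S _.
rewrite sum_ffunE big_mkcond; apply: eq_bigr => T _; rewrite !ffunE eq_sym.
by case: eqP => _; rewrite /GRing.scale /= ?mulr1 ?mulr0.
Qed.

Lemma cl_decomp (x : clifford) : x = \sum_S x S *: cl_basis S.
Proof.
apply/ffunP => U; rewrite sum_ffunE (bigD1 U) //= big1 => [|S SU].
  by rewrite !ffunE eqxx addr0 /GRing.scale /= mulr1.
by rewrite !ffunE eq_sym (negbTE SU) /GRing.scale /= mulr0.
Qed.

Lemma cl_mulDl : left_distributive cl_mul +%R.
Proof.
move=> x y z; apply/ffunP => U; rewrite !ffunE -big_split; apply: eq_bigr => S _.
rewrite -big_split; apply: eq_bigr => T _; rewrite !ffunE /=; ring.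
Qed.

Lemma cl_mulDr : right_distributive cl_mul +%R.
Proof.
move=> x y z; apply/ffunP => U; rewrite !ffunE -big_split; apply: eq_bigr => S _.
rewrite -big_split; apply: eq_bigr => T _; rewrite !ffunE /=; ring.
Qed.

Lemma cl_scaleAl (a : R) x y : a *: cl_mul x y = cl_mul (a *: x) y.
Proof.
apply/ffunP => U; rewrite !ffunE scaler_sumr; apply: eq_bigr => S _.
rewrite scaler_sumr; apply: eq_bigr => T _; rewrite !ffunE /GRing.scale /=; ring.
Qed.

Lemma cl_scaleAr (a : R) x y : a *: cl_mul x y = cl_mul x (a *: y).
Proof.
apply/ffunP => U; rewrite !ffunE scaler_sumr; apply: eq_bigr => S _.
rewrite scaler_sumr; apply: eq_bigr => T _; rewrite !ffunE /GRing.scale /=; ring.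
Qed.

Lemma cl_mul_basis S T :
  cl_mul (cl_basis S) (cl_basis T) = cl_sign S T *: cl_basis (symdiff S T).
Proof.
rewrite cl_mulE (bigD1 S) //= [X in _ + X]big1 => [|S' SS'].
  rewrite addr0 (bigD1 T) //= big1 => [|T' TT'].
    by rewrite addr0 !ffunE !eqxx !mulr1.
  by rewrite !ffunE (negbTE TT') !mulr0 scale0r.
by apply: big1 => T' _; rewrite !ffunE (negbTE SS') mul0r mulr0 scale0r.
Qed.

Lemma cl_mul_suml (I : finType) (F : I -> clifford) y :
  cl_mul (\sum_i F i) y = \sum_i cl_mul (F i) y.
Proof.
apply: (big_morph (cl_mul^~ y)) => [u v|]; first exact: cl_mulDl.
by rewrite -[X in cl_mul X _](scale0r (0 : clifford)) -cl_scaleAl scale0r.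
Qed.

Lemma cl_mul_sumr (I : finType) (F : I -> clifford) x :
  cl_mul x (\sum_i F i) = \sum_i cl_mul x (F i).
Proof.
apply: (big_morph (cl_mul x)) => [u v|]; first exact: cl_mulDr.
by rewrite -[X in cl_mul _ X](scale0r (0 : clifford)) -cl_scaleAr scale0r.
Qed.

Lemma cl_mulA : associative cl_mul.
Proof.
move=> x y z; rewrite (cl_decomp x) !cl_mul_suml; apply: eq_bigr => S _.
rewrite -!cl_scaleAl; congr (_ *: _).
rewrite (cl_decomp y) !(cl_mul_suml, cl_mul_sumr); apply: eq_bigr => T _.
rewrite -?(cl_scaleAl, cl_scaleAr); congr (_ *: _).
rewrite (cl_decomp z) !cl_mul_sumr; apply: eq_bigr => U _.
rewrite -?(cl_scaleAl, cl_scaleAr); congr (_ *: _).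
rewrite !cl_mul_basis -cl_scaleAr -cl_scaleAl !cl_mul_basis !scalerA symdiffA.
by rewrite cl_signDl cl_signDr; congr (_ *: _); ring.
Qed.

Lemma cl_mul1l : left_id (cl_basis finset.set0) cl_mul.
Proof.
move=> x; rewrite (cl_decomp x) cl_mul_sumr; apply: eq_bigr => S _.
by rewrite -cl_scaleAr cl_mul_basis cl_sign0l symdiff0s scale1r.
Qed.

Lemma cl_mul1r : right_id (cl_basis finset.set0) cl_mul.
Proof.
move=> x; rewrite (cl_decomp x) cl_mul_suml; apply: eq_bigr => S _.
by rewrite -cl_scaleAl cl_mul_basis cl_sign0r symdiffs0 scale1r.
Qed.

Lemma cl_basis_neq0 : cl_basis finset.set0 != 0.
Proof.
by apply/eqP => /ffunP/(_ finset.set0)/eqP; rewrite !ffunE eqxx oner_eq0.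
Qed.

HB.instance Definition _ := GRing.Zmodule_isNzRing.Build clifford
  cl_mulA cl_mul1l cl_mul1r cl_mulDl cl_mulDr cl_basis_neq0.
HB.instance Definition _ := GRing.Lmodule_isLalgebra.Build R clifford cl_scaleAl.
HB.instance Definition _ := GRing.Lalgebra_isAlgebra.Build R clifford cl_scaleAr.

Definition cl_vec (v : 'rV[R]_n) : clifford :=
  \sum_i v 0 i *: cl_basis [set i].

Lemma cl_vec_sqr v : cl_vec v * cl_vec v = - (\sum_i v 0 i ^+ 2)%:A.
Proof.
have sgnE i j : cl_sign [set i] [set j] = if (j <= i)%N then -1 else 1.
  by rewrite /cl_sign big_set1 big_mkcondr big_set1.
pose F i j := (v 0 i * v 0 j) *: (cl_basis [set i] * cl_basis [set j]).
have FE i j : F i j + F j i = if i == j then (- (2 * v 0 i ^+ 2))%:A else 0.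
  have ed k l : cl_basis [set k] * cl_basis [set l] =
      cl_sign [set k] [set l] *: cl_basis (symdiff [set k] [set l]).
    exact: cl_mul_basis.
  have sC : symdiff [set j] [set i] = symdiff [set i] [set j].
    by apply/setP => k; rewrite !in_symdiff addbC.
  rewrite /F !ed !sgnE sC !scalerA -scalerDl.
  case: ltngtP => [ji|ij|/ord_inj <-].
  - have -> : (i == j) = false by apply/eqP => E; rewrite E ltnn in ji.
    by rewrite [X in X *: _](_ : _ = 0) ?scale0r //; ring.
  - have -> : (i == j) = false by apply/eqP => E; rewrite E ltnn in ij.
    by rewrite [X in X *: _](_ : _ = 0) ?scale0r //; ring.
  - rewrite eqxx; congr (_ *: _); first by ring.
    by congr cl_basis; apply/setP => k; rewrite in_symdiff addbb inE.
have sqE : cl_vec v * cl_vec v = \sum_i \sum_j F i j.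
  rewrite /cl_vec mulr_suml; apply: eq_bigr => i _; rewrite mulr_sumr.
  by apply: eq_bigr => j _; rewrite -scalerAl -scalerAr scalerA.
have : \sum_i \sum_j (F i j + F j i) = - (2 * \sum_i v 0 i ^+ 2)%:A.
  rewrite mulr_sumr -scaleNr -sumrN scaler_suml; apply: eq_bigr => i _.
  rewrite (bigD1 i) //= FE eqxx big1 ?addr0 // => j ji.
  by rewrite FE eq_sym (negbTE ji).
under eq_bigr do rewrite big_split /=.
rewrite big_split /= [X in _ + X]exchange_big /= -sqE -mulr2n -scaler_nat.
rewrite -scalerA -scalerN.
by move/(scalerI _); apply; rewrite pnatr_eq0.
Qed.

Definition spin_group : set clifford :=
  [set x | exists s : seq 'rV[R]_n,
    [/\ ~~ odd (size s), forall v, v \in s -> \sum_i v 0 i ^+ 2 = 1 &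
        x = \prod_(v <- s) cl_vec v]].

End Clifford.

Arguments spin_group : clear implicits.

Section Spin7.
Variable R : realType.
Local Notation OO := (octonion_alg R).

(* The isometry from R^7 to the imaginary octonions sending the canonical basis
   to i, j, k, l, il, jl, kl. *)
Definition im_octonion (v : 'rV[R]_7) : OO :=
  ((Complex 0 (v 0 0), Complex (v 0 1) (v 0 2)),
   (Complex (v 0 3) (v 0 4), Complex (v 0 5) (v 0 6))).

(* Right multiplication by an imaginary octonion u squares to - |u| ^+ 2, which
   makes O a module over the Clifford algebra of R^7.  Its restriction to Spin(7)
   is the real spin representation of dimension 8.  (Left multiplications yield
   the image of the subgroup defined here under octonion conjugation, for which
   the twisting condition would read phi (x v) = theta x * phi v.) *)
Definition spin_rep (x : clifford R 7) : 'End(avec OO 1) :=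
  \sum_(S : {set 'I_7}) x S *:
    \big[(@comp_lfun _ _ _ _) / \1%VF]_(i in S) rmul 1 (im_octonion (delta_mx 0 i)).

Definition Spin7_group : set 'End(avec OO 1) :=
  [set spin_rep x | x in spin_group R 7].

End Spin7.

Arguments Spin7_group : clear implicits.

(* Main.v *)
(* A twisted isomorphism forces theta 1 = 1.  Over C this leaves theta = id and
   complex conjugation, which has determinant -1.  Over H the twisting condition
   makes theta an automorphism, hence inner, say theta x = b^-1 x b, and phi
   followed by right multiplication by b^-1 is H-linear.  Over O, alternativity
   shows that right multiplication by a unit imaginary octonion u is twisted by
   the half turn x |-> u x u^-1, the opposite of the reflection in u on
   imaginary octonions; this gives Spin(7) inside G_O(1).  Conversely, as in the
   Cartan-Dieudonne theorem, finitely many half turns bring theta to +-id on the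
   imaginary octonions, the sign being the parity of their number.  The sign -
   would give theta x = conj x, which is never a twist, so their number is even,
   and the remaining phi is right O-linear, hence multiplication by an element of
   the nucleus, +1 or -1. *)

From HB Require Import structures.
Require Import Defs.
From mathcomp Require Import all_boot all_order all_algebra.
From mathcomp Require Import classical_sets reals.
From mathcomp Require Import complex ring lra.

Set Implicit Arguments.
Unset Strict Implicit.
Unset Printing Implicit Defensive.

(* [Defs.orthogonal] would otherwise be shadowed by the one of sesquilinear forms. *)
Import Defs Order.TTheory GRing.Theory Num.Theory.

Local Open Scope ring_scope.

Lemma linfun_exists (F : fieldType) (U V : vectType F) (g : U -> V) :
  linear g -> exists f : 'Hom(U, V), forall x, f x = g x.
Proof.
move=> gL; pose L := GRing.isLinear.Build F U V _ g gL.
pose h : {linear U -> V} := HB.pack g L.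
by exists (linfun h) => x; rewrite lfunE.
Qed.

(** * Normed division algebras: the inner product and determinants of isometries *)

Section NormedDivAlgTheory.
Context {R : realType} {A : normedDivAlg R}.
Implicit Types (a : R) (x y z : A).

Lemma nda_mulDl x y z : nda_mul (x + y) z = nda_mul x z + nda_mul y z.
Proof. exact: ndl_mulDl (nda_laws A) _ _ _. Qed.

Lemma nda_mulDr x y z : nda_mul x (y + z) = nda_mul x y + nda_mul x z.
Proof. exact: ndl_mulDr (nda_laws A) _ _ _. Qed.

Lemma nda_mulZl a x y : nda_mul (a *: x) y = a *: nda_mul x y.
Proof. by rewrite (ndl_scaleAl (nda_laws A)). Qed.

Lemma nda_mulZr a x y : nda_mul x (a *: y) = a *: nda_mul x y.
Proof. by rewrite (ndl_scaleAr (nda_laws A)). Qed.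

Lemma nda_mulNr x y : nda_mul x (- y) = - nda_mul x y.
Proof. by rewrite -!scaleN1r nda_mulZr. Qed.

Lemma nda_mul1l x : nda_mul (nda_one A) x = x.
Proof. exact: ndl_mul1l (nda_laws A) _. Qed.

Lemma nda_mul1r x : nda_mul x (nda_one A) = x.
Proof. exact: ndl_mul1r (nda_laws A) _. Qed.

Lemma nda_conjP a x y : nda_conj (a *: x + y) = a *: nda_conj x + nda_conj y.
Proof.
have conjE z : nda_conj z = (2 * nda_re z) *: nda_one A - z.
  by rewrite -(ndl_conjE (nda_laws A)) addrC addKr.
rewrite !conjE (ndl_reP (nda_laws A)) mulrDr scalerDl scalerBr scalerA.
by rewrite (mulrCA 2 a) opprD addrACA.
Qed.

Lemma nda_innerPl a x y z :
  nda_inner (a *: x + y) z = a * nda_inner x z + nda_inner y z.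
Proof. by rewrite /nda_inner nda_mulDl nda_mulZl (ndl_reP (nda_laws A)). Qed.

Lemma nda_innerPr a x y z :
  nda_inner z (a *: x + y) = a * nda_inner z x + nda_inner z y.
Proof.
by rewrite /nda_inner nda_conjP nda_mulDr nda_mulZr (ndl_reP (nda_laws A)).
Qed.

Lemma nda_inner0l z : nda_inner 0 z = 0.
Proof.
have := nda_innerPl 1 0 0 z; rewrite scaler0 addr0 mul1r => h.
by apply: (addrI (nda_inner 0 z)); rewrite addr0 -h.
Qed.

Lemma nda_inner0r z : nda_inner z 0 = 0.
Proof.
have := nda_innerPr 1 0 0 z; rewrite scaler0 addr0 mul1r => h.
by apply: (addrI (nda_inner z 0)); rewrite addr0 -h.
Qed.

Lemma nda_innerDl x y z : nda_inner (x + y) z = nda_inner x z + nda_inner y z.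
Proof. by rewrite -{1}[x]scale1r nda_innerPl mul1r. Qed.

Lemma nda_innerDr x y z : nda_inner z (x + y) = nda_inner z x + nda_inner z y.
Proof. by rewrite -{1}[x]scale1r nda_innerPr mul1r. Qed.

Lemma nda_innerZl a x z : nda_inner (a *: x) z = a * nda_inner x z.
Proof. by rewrite -[_ *: _]addr0 nda_innerPl nda_inner0l addr0. Qed.

Lemma nda_innerZr a x z : nda_inner z (a *: x) = a * nda_inner z x.
Proof. by rewrite -[_ *: _]addr0 nda_innerPr nda_inner0r addr0. Qed.

Lemma nda_innerNl x z : nda_inner (- x) z = - nda_inner x z.
Proof. by rewrite -scaleN1r nda_innerZl mulN1r. Qed.

Lemma nda_innerNr x z : nda_inner z (- x) = - nda_inner z x.
Proof. by rewrite -scaleN1r nda_innerZr mulN1r. Qed.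

Lemma nda_inner_ge0 x : 0 <= nda_inner x x.
Proof. exact: ndl_norm_ge0 (nda_laws A) _. Qed.

Lemma nda_inner_eq0 x : nda_inner x x = 0 -> x = 0.
Proof. exact: ndl_norm_eq0 (nda_laws A) _. Qed.

Lemma nda_normM x y :
  nda_inner (nda_mul x y) (nda_mul x y) = nda_inner x x * nda_inner y y.
Proof. exact: ndl_normM (nda_laws A) _ _. Qed.

(** Multiplicativity of the norm excludes zero divisors, so cancellation needs neither inverses nor
    associativity. *)
Lemma nda_mulI x y z : x != 0 -> nda_mul x y = nda_mul x z -> y = z.
Proof.
move=> x0 e; apply/eqP; rewrite -subr_eq0; apply/eqP/nda_inner_eq0/eqP.
have : nda_mul x (y - z) = 0 by rewrite nda_mulDr nda_mulNr e subrr.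
move=> /(congr1 (fun t => nda_inner t t)); rewrite nda_normM nda_inner0l.
move/eqP; rewrite mulf_eq0 => /orP[/eqP/nda_inner_eq0 xE|//].
by rewrite xE eqxx in x0.
Qed.

Lemma nda_norm_eq1 x : (nda_norm x = 1) <-> (nda_inner x x = 1).
Proof.
rewrite /nda_norm; split=> [h|->]; last exact: sqrtr1.
by rewrite -(sqr_sqrtr (nda_inner_ge0 x)) h expr1n.
Qed.

(** Polarisation of [nda_normM]. Symmetry of the inner product is checked in coordinates for each
    algebra, in [quat_innerC] and [oct_innerC]. *)
Lemma nda_inner_mull (innerC : forall x y, nda_inner x y = nda_inner y x) x y z :
  nda_inner (nda_mul z x) (nda_mul z y) = nda_inner z z * nda_inner x y.
Proof.
have := nda_normM z (x + y); rewrite nda_mulDr !nda_innerDl !nda_innerDr !nda_normM.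
rewrite (innerC (nda_mul z y) (nda_mul z x)) (innerC y x) => h.
apply: (mulfI (x := 2)); first by rewrite pnatr_eq0.
by lra.
Qed.

Lemma nda_inner_mulr (innerC : forall x y, nda_inner x y = nda_inner y x) x y z :
  nda_inner (nda_mul x z) (nda_mul y z) = nda_inner z z * nda_inner x y.
Proof.
have := nda_normM (x + y) z; rewrite nda_mulDl !nda_innerDl !nda_innerDr !nda_normM.
rewrite (innerC (nda_mul y z) (nda_mul x z)) (innerC y x) => h.
apply: (mulfI (x := 2)); first by rewrite pnatr_eq0.
by lra.
Qed.

Definition preserves_inner (f : 'End(A)) :=
  forall x y, nda_inner (f x) (f y) = nda_inner x y.

Let e := vbasis {:A}.
Let ebP : basis_of {:A} e := vbasisP _.

Lemma nda_inner_suml (I : finType) (F : I -> A) z :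
  nda_inner (\sum_i F i) z = \sum_i nda_inner (F i) z.
Proof.
apply: (big_morph (fun t => nda_inner t z)); first by move=> *; rewrite nda_innerDl.
exact: nda_inner0l.
Qed.

Lemma nda_inner_sumr (I : finType) (F : I -> A) z :
  nda_inner z (\sum_i F i) = \sum_i nda_inner z (F i).
Proof.
apply: (big_morph (fun t => nda_inner z t)); first by move=> *; rewrite nda_innerDr.
exact: nda_inner0r.
Qed.

(* The matrix M of an isometry satisfies M G M^T = G for the Gram matrix G. *)
Lemma det_isometry_sqr (f : 'End(A)) : preserves_inner f ->
  \det (passmx.mxof e e f) ^+ 2 = 1.
Proof.
move=> fI; set M := passmx.mxof e e f.
pose G : 'M[R]_(\dim {:A}) := \matrix_(i, j) nda_inner e`_i e`_j.
have gramE u w : nda_inner (passmx.vecof e u) (passmx.vecof e w) = (u *m G *m w^T) 0 0.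
  rewrite !mxE /passmx.vecof nda_inner_sumr; apply: eq_bigr => j _.
  rewrite nda_innerZr nda_inner_suml !mxE mulrC; congr (_ * _).
  by apply: eq_bigr => i _; rewrite nda_innerZl mxE.
have MGM : M *m G *m M^T = G.
  apply/matrixP => i j; have -> : G i j = nda_inner (f e`_i) (f e`_j).
    by rewrite fI mxE.
  rewrite -!(passmx.vecof_delta e) !(passmx.hom_vecof e ebP) gramE -!rowE -row_mul.
  by rewrite !mxE; apply: eq_bigr => k _; rewrite !mxE.
(* A row vector u with u G = 0 would be the coordinates of an element of norm 0. *)
have G0 : \det G != 0.
  apply/negP => /det0P[u u0 uG].
  have : nda_inner (passmx.vecof e u) (passmx.vecof e u) = 0.
    by rewrite gramE uG mul0mx mxE.
  by move/nda_inner_eq0/eqP; rewrite (passmx.vecof_eq0 ebP) (negbTE u0).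
move: (congr1 determinant MGM); rewrite !det_mulmx det_tr => h.
by apply: (mulfI G0); rewrite mulr1 -[RHS]h; ring.
Qed.

Lemma special_orthogonal_comp (f g : 'End(A)) :
  special_orthogonal A f -> special_orthogonal A g ->
  special_orthogonal A (f \o g)%VF.
Proof.
move=> [fI fD] [gI gD]; split=> [x y|]; first by rewrite !comp_lfunE fI gI.
by rewrite (passmx.mxof_comp e e ebP) det_mulmx fD gD mulr1.
Qed.

(** The determinant of an isometry is 1 or -1, so that of its square is 1. Writing a map as a square
    thus replaces the computation of a determinant in coordinates. *)
Lemma special_orthogonal_sqr (f : 'End(A)) :
  preserves_inner f -> special_orthogonal A (f \o f)%VF.
Proof.
move=> fI; split=> [x y|]; first by rewrite !comp_lfunE !fI.
by rewrite (passmx.mxof_comp e e ebP) det_mulmx -expr2 det_isometry_sqr.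
Qed.

Lemma special_orthogonal1 : special_orthogonal A \1%VF.
Proof.
split=> [x y|]; first by rewrite !id_lfunE.
by rewrite passmx.mxof1 ?det1 // (basis_free ebP).
Qed.

End NormedDivAlgTheory.

(** * General properties of twisted isomorphisms *)

Section AvecTheory.
Context {R : realType} {A : normedDivAlg R} {n : nat}.
Implicit Types (v w : avec A n).

Lemma vmul1 v : vmul v (nda_one A) = v.
Proof. by apply/ffunP => i; rewrite ffunE nda_mul1r. Qed.

Lemma vinner_eq0 v : vinner v v = 0 -> v = 0.
Proof.
move/psumr_eq0P => h; apply/ffunP => i; rewrite ffunE.
by apply: nda_inner_eq0; apply: h => // j _; apply: nda_inner_ge0.
Qed.

Lemma orthogonal1 : orthogonal A n \1%VF.
Proof. by move=> v w; rewrite !id_lfunE. Qed.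

Lemma orthogonal_comp (f g : 'End(avec A n)) :
  orthogonal A n f -> orthogonal A n g -> orthogonal A n (f \o g)%VF.
Proof. by move=> fO gO v w; rewrite !comp_lfunE fO gO. Qed.

Lemma orthogonal_inj (f : 'End(avec A n)) v :
  orthogonal A n f -> f v = 0 -> v = 0.
Proof.
move=> fO fv; apply: vinner_eq0; rewrite -fO fv /vinner big1 // => i _.
by rewrite ffunE nda_inner0l.
Qed.

Lemma linear_isometries_twisted (f : 'End(avec A n)) :
  linear_isometries A n f -> twisted_isomorphisms A n f.
Proof.
move=> [fO fL]; split=> //; exists \1%VF; first exact: special_orthogonal1.
by move=> v x; rewrite id_lfunE fL.
Qed.

Lemma twisted1 : twisted_isomorphisms A n \1%VF.
Proof.
apply: linear_isometries_twisted; split=> [|v x]; first exact: orthogonal1.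
by rewrite !id_lfunE.
Qed.

Lemma twisted_comp (f g : 'End(avec A n)) :
  twisted_isomorphisms A n f -> twisted_isomorphisms A n g ->
  twisted_isomorphisms A n (f \o g)%VF.
Proof.
move=> [fO [t tS ft]] [gO [s sS gs]]; split; first exact: orthogonal_comp.
exists (t \o s)%VF; first exact: special_orthogonal_comp.
by move=> v x; rewrite !comp_lfunE gs ft.
Qed.

Lemma orthogonal_neq0 (f : 'End(avec A n)) : (0 < n)%N ->
    nda_one A != 0 -> orthogonal A n f -> exists v i, f v i != 0.
Proof.
move=> n0 one0 fO; pose v : avec A n := [ffun=> nda_one A]; exists v.
apply/existsP; apply: contraT; rewrite negb_exists => /forallP fv0.
have /(orthogonal_inj fO)/ffunP/(_ (Ordinal n0)) : f v = 0.
  by apply/ffunP => i; rewrite ffunE; apply/eqP; rewrite -[_ == _]negbK fv0.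
by rewrite !ffunE => /eqP; rewrite (negbTE one0).
Qed.

(** At a nonzero coordinate c of some f v, the twist by 1 reads c = c * theta 1, and c cancels. *)
Lemma twist1 (f : 'End(avec A n)) (theta : 'End(A)) : (0 < n)%N ->
    orthogonal A n f -> (forall v x, f (vmul v x) = vmul (f v) (theta x)) ->
  theta (nda_one A) = nda_one A.
Proof.
(* The laws allow the zero algebra, where 1 = 0. *)
move=> n0 fO ft; have [->|one0] := eqVneq (nda_one A) 0; first exact: linear0.
have [v [i fvi]] := orthogonal_neq0 n0 one0 fO.
apply: (nda_mulI fvi); rewrite nda_mul1r.
have := congr1 (fun w : avec A n => w i) (ft v (nda_one A)).
by rewrite vmul1 ffunE => <-.
Qed.

End AvecTheory.

(** * Real and complex numbers *)

Section RealCase.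
Variables (R : realType) (n : nat).

(** Right multiplication by a real number is scaling, with which every linear map commutes, so theta
    = id serves for each isometry. *)
Lemma twisted_real : twisted_isomorphisms (real_alg R) n = O_group R n.
Proof.
apply/seteqP; split=> [f [] //|f fO]; apply: linear_isometries_twisted.
split=> // v x; have vmulE (w : avec (real_alg R) n) : vmul w x = (x : R) *: w.
  by apply/ffunP => i; rewrite !ffunE; apply: mulrC.
by rewrite !vmulE linearZ.
Qed.

End RealCase.

(** The off-diagonal entries of M M are b and c times the trace, so they vanish once the trace is
    nonzero. The size is 2 only up to an equation, because it will be [\dim {:C}]. *)
Lemma involution_scalar_mx (F : numFieldType) (m : nat) (M : 'M[F]_m) :
  m = 2 -> M *m M = 1%:M -> \det M = 1 -> exists c, M = c%:M.
Proof.
move=> m2; move: M; rewrite m2 => M MM.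
rewrite (expand_det_row _ 0) !big_ord_recl big_ord0 addr0.
rewrite /cofactor !det_mx11 !mxE /= expr0 expr1 mul1r mulN1r.
have -> : lift 0 0 = 1 :> 'I_2 by apply: val_inj.
have -> : lift 1 0 = 0 :> 'I_2 by apply: val_inj.
have ME i j : M i 0 * M 0 j + M i 1 * M 1 j = (i == j)%:R.
  move/matrixP/(_ i j): MM; rewrite !mxE !big_ord_recl big_ord0 addr0.
  by have -> : lift 0 0 = 1 :> 'I_2 by apply: val_inj.
move: (ME 0 0) (ME 0 1) (ME 1 0) (ME 1 1) => /=.
set a := M 0 0; set b := M 0 1; set c := M 1 0; set d := M 1 1.
rewrite !mulr1n !mulr0n => e1 e2 e3 e4 e5.
(* Adding a a + b c = 1 and the determinant a d - b c = 1 shows that the trace is nonzero. *)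
have ad : a * (a + d) = 2.
  have -> : a * (a + d) = (a * a + b * c) + (a * d + b * - c) by ring.
  by rewrite e1 e5.
have ad0 : a + d != 0.
  by apply/eqP => z; move/eqP: ad; rewrite z mulr0 eq_sym pnatr_eq0.
have b0 : b = 0 by apply: (mulIf ad0); rewrite mul0r -e2; ring.
have c0 : c = 0 by apply: (mulIf ad0); rewrite mul0r -e3; ring.
have da : d = a.
  apply: (mulIf ad0); rewrite ad; move: e4 e5; rewrite b0 c0 => e4 e5.
  have -> : d * (a + d) = (a * d + 0 * - 0) + (0 * 0 + d * d) by ring.
  by rewrite e4 e5.
exists a; apply/matrixP => i j; rewrite !mxE.
have I2 (k : 'I_2) : k = 0 \/ k = 1.
  by case: k => [[|[|k]] kP] //; [left|right]; apply: val_inj.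
by case: (I2 i) (I2 j) => -> [] ->.
Qed.

Section ComplexCase.
Variable R : realType.
Local Notation C := (complex_alg R).

Lemma complex_innerE (a b c d : R) :
  nda_inner (Complex a b : C) (Complex c d : C) = a * c + b * d.
Proof. by rewrite /nda_inner /=; ring. Qed.

(* An orthogonal map fixing 1 sends i to i or -i.  In the second case it is an
   involution of determinant 1 in dimension 2, hence a scalar. *)
Lemma special_orthogonal_complex (theta : 'End(C)) :
  special_orthogonal C theta -> theta (nda_one C) = nda_one C ->
  theta = \1%VF.
Proof.
move=> [tI tD] t1.
have tE (a b : R) : theta (Complex a b : C) =
    a *: (nda_one C) + b *: theta (Complex 0 1 : C).
  rewrite -[in RHS]t1 -!linearZ -linearD; congr (theta _).
  by apply/eqP; rewrite eq_complex /= !mulr1 !mulr0 addr0 add0r !eqxx.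
case ti: (theta (Complex 0 1 : C)) tE => [p q] tE.
have p0 : p = 0.
  have := tI (Complex 0 1 : C) (nda_one C).
  by rewrite t1 ti !complex_innerE !mulr1 !mulr0 !addr0.
have : q * q = 1.
  have := tI (Complex 0 1 : C) (Complex 0 1 : C).
  by rewrite ti !complex_innerE p0 !mulr1 !mul0r !add0r.
move/eqP; rewrite -expr2 sqrf_eq1 => /orP[] /eqP q1.
  apply/lfunP => -[a b]; rewrite id_lfunE tE p0 q1.
  by apply/eqP; rewrite eq_complex /= !mulr1 !mulr0 addr0 add0r !eqxx.
pose e := vbasis {:C}; have eP : basis_of {:C} e := vbasisP _.
have tt : passmx.mxof e e theta *m passmx.mxof e e theta = 1%:M.
  rewrite -(passmx.mxof_comp e e eP) -(passmx.mxof1 (basis_free eP)); congr passmx.mxof.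
  apply/lfunP => -[a b]; rewrite comp_lfunE id_lfunE !tE p0 q1.
  by apply/eqP; rewrite eq_complex /=; apply/andP; split; apply/eqP; ring.
have [c tc] := involution_scalar_mx (dimvf C) tt tD.
have {}tc x : theta x = c *: x.
  rewrite -[theta](passmx.mxofK eP eP) tc passmx.hommxE // mul_mx_scalar.
  rewrite -[in RHS](passmx.rVofK eP x) /passmx.vecof scaler_sumr.
  by apply: eq_bigr => i _; rewrite mxE scalerA.
(* The scalar would be 1 by the value at 1 and -1 by the value at i. *)
have := tc (nda_one C); rewrite t1 => /eqP; rewrite eq_complex /= => /andP[/eqP c1 _].
have := tc (Complex 0 1 : C); rewrite ti p0 q1 => /eqP; rewrite eq_complex /=.
move=> /andP[_ /eqP]; move: c1; rewrite !mulr1 => <- /eqP.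
by rewrite eq_sym -subr_eq0 opprK (pnatr_eq0 R 2).
Qed.

Lemma twisted_complex n : (0 < n)%N -> twisted_isomorphisms C n = U_group R n.
Proof.
move=> n0; apply/seteqP; split=> [f [fO [t tS ft]]|f]; last first.
  exact: linear_isometries_twisted.
have t1 := special_orthogonal_complex tS (twist1 n0 fO ft).
by split=> // v x; rewrite ft t1 id_lfunE.
Qed.

End ComplexCase.

(** * Quaternions *)

Section QuaternionCase.
Variable R : realType.
Local Notation H := (quaternion_alg R).
Implicit Types x y z : H.

Local Ltac quat_eq :=
  congr (_, _); apply/eqP; rewrite eq_complex; apply/andP;
  split; apply/eqP => /=; ring.

Let qi : H := (Complex 0 1, 0).
Let qj : H := (0, 1).
Let qk : H := (0, Complex 0 1).
Let q1 : H := nda_one H.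

Lemma quat_innerC x y : nda_inner x y = nda_inner y x.
Proof.
by move: x y => [[x1 x2] [x3 x4]] [[y1 y2] [y3 y4]];
  rewrite /nda_inner /= /cd_re /cd_mul /=; ring.
Qed.

Lemma quat_inner1 x : nda_inner x (nda_one H) = nda_re x.
Proof.
by move: x => [[x1 x2] [x3 x4]]; rewrite /nda_inner /= /cd_re /cd_mul /=; ring.
Qed.

Lemma quat_mul_conj x : nda_mul x (nda_conj x) = nda_inner x x *: nda_one H.
Proof.
by move: x => [[x1 x2] [x3 x4]]; rewrite /nda_inner /= /cd_re /cd_mul /=; quat_eq.
Qed.

Lemma quat_conj_mul x : nda_mul (nda_conj x) x = nda_inner x x *: nda_one H.
Proof.
by move: x => [[x1 x2] [x3 x4]]; rewrite /nda_inner /= /cd_re /cd_mul /=; quat_eq.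
Qed.

Lemma quat_inner_conj x : nda_inner (nda_conj x) (nda_conj x) = nda_inner x x.
Proof. by rewrite /nda_inner quat_conjK quat_reC. Qed.

Lemma quat_decomp x :
  exists a b c d, x = a *: q1 + b *: qi + c *: qj + d *: qk.
Proof. by move: x => [[x1 x2] [x3 x4]]; exists x1, x2, x3, x4; quat_eq. Qed.

Let units_table : [/\ nda_mul qi qi = - q1, nda_mul qi qj = qk & nda_mul qi qk = - qj] /\
  [/\ nda_mul qj qi = - qk, nda_mul qj qj = - q1 & nda_mul qj qk = qi] /\
  [/\ nda_mul qk qi = qj, nda_mul qk qj = - qi & nda_mul qk qk = - q1].
Proof. by do ![split]; quat_eq. Qed.

(* An average over the group {+-1, +-i, +-j, +-k}, hence an intertwiner between
   x and t x when t is an automorphism. *)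
Let avg (t : 'End(H)) c : H :=
  \sum_(e <- [:: q1; qi; qj; qk]) nda_mul (nda_mul e c) (t (nda_conj e)).

(* The sum of c q conj c over the basis is 4 Re q, and t preserves real parts. *)
Lemma quat_avg_sum (t : 'End(H)) : preserves_inner t -> t q1 = q1 ->
  \sum_(c <- [:: q1; qi; qj; qk]) nda_mul (avg t c) (nda_conj c) = 4 *: q1.
Proof.
move=> tI t1.
have tc x : nda_re x = 0 -> t (nda_conj x) = - t x.
  move=> x0; rewrite -linearN; congr (t _).
  have := ndl_conjE (nda_laws H) x; rewrite x0 mulr0 scale0r => /eqP.
  by rewrite addrC addr_eq0 => /eqP.
have t0 x : nda_re x = 0 -> nda_re (t x) = 0.
  by move=> x0; rewrite -quat_inner1 -/q1 -t1 tI quat_inner1.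
have ri : nda_re qi = 0 by [].
have rj : nda_re qj = 0 by [].
have rk : nda_re qk = 0 by [].
have c1 : nda_conj q1 = q1 by quat_eq.
rewrite /avg !big_cons !big_nil !addr0 c1 t1 (tc _ ri) (tc _ rj) (tc _ rk).
move: (t qi) (t qj) (t qk) (t0 _ ri) (t0 _ rj) (t0 _ rk).
move=> [[x1 x2] [x3 x4]] [[y1 y2] [y3 y4]] [[z1 z2] [z3 z4]] /=.
rewrite /cd_re /= => -> -> ->; rewrite /cd_mul /=; quat_eq.
Qed.

(** Left multiplication by i, j or k permutes the four terms of the average up to the sign of e, and
    a term does not change when e changes sign. Linearity extends the relation from the units to all
    x. *)
Lemma quat_avg_comm (t : 'End(H)) c x :
    t q1 = q1 -> (forall x y, t (nda_mul x y) = nda_mul (t x) (t y)) ->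
  nda_mul x (avg t c) = nda_mul (avg t c) (t x).
Proof.
move=> t1 tM; pose T e := nda_mul (nda_mul e c) (t (nda_conj e)).
(* The factor t b on the right absorbs the conj b contained in t (conj (b e)), as t is
   multiplicative and b is a unit. *)
have TE e b : nda_inner b b = 1 -> nda_mul b (T e) = nda_mul (T (nda_mul b e)) (t b).
  move=> b1; rewrite /T -(quat_mulA _ _ (t b)) -tM quat_conjM.
  by rewrite -(quat_mulA _ _ b) quat_conj_mul b1 scale1r nda_mul1r !quat_mulA.
have TN e : T (- e) = T e.
  have NE (y : H) : - y = -1 *: y by rewrite scaleN1r.
  rewrite /T !NE -[-1 *: e]addr0 nda_conjP.
  have -> : nda_conj (0 : H) = 0 by quat_eq.
  by rewrite !addr0 linearZ !nda_mulZl nda_mulZr scalerA mulrNN mulr1 scale1r.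
have avgE : avg t c = T q1 + T qi + T qj + T qk.
  by rewrite /avg !big_cons big_nil addr0 !addrA.
have [[ii ij ik] [[ji jj jk] [ki kj kk]]] := units_table.
have qn : [/\ nda_inner qi qi = 1, nda_inner qj qj = 1 & nda_inner qk qk = 1].
  by split; rewrite /nda_inner /= /cd_re /cd_mul /=; ring.
have [ni nj nk] := qn.
have mul1 e : nda_mul e q1 = e by rewrite nda_mul1r.
have bi : nda_mul qi (avg t c) = nda_mul (avg t c) (t qi).
  rewrite avgE !nda_mulDr !TE // ii ij ik mul1 !TN -!nda_mulDl.
  by congr nda_mul; rewrite [LHS](ACl (2*1*4*3)).
have bj : nda_mul qj (avg t c) = nda_mul (avg t c) (t qj).
  rewrite avgE !nda_mulDr !TE // ji jj jk mul1 !TN -!nda_mulDl.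
  by congr nda_mul; rewrite [LHS](ACl (3*4*1*2)).
have bk : nda_mul qk (avg t c) = nda_mul (avg t c) (t qk).
  rewrite avgE !nda_mulDr !TE // ki kj kk mul1 !TN -!nda_mulDl.
  by congr nda_mul; rewrite [LHS](ACl (4*3*2*1)).
have [a [b [d [g ->]]]] := quat_decomp x.
have -> : t (a *: q1 + b *: qi + d *: qj + g *: qk) =
    a *: q1 + b *: t qi + d *: t qj + g *: t qk by rewrite !linearD !linearZ /= t1.
rewrite !nda_mulDl !nda_mulZl bi bj bk nda_mul1l.
by rewrite !nda_mulDr !nda_mulZr nda_mul1r.
Qed.

(** By [quat_avg_sum] the averages cannot vanish for all four c; a nonzero one, divided by its norm,
    is b. *)
Lemma quat_skolem_noether (t : 'End(H)) : preserves_inner t ->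
    t q1 = q1 -> (forall x y, t (nda_mul x y) = nda_mul (t x) (t y)) ->
  exists2 b : H, nda_inner b b = 1 & forall x, nda_mul x b = nda_mul b (t x).
Proof.
move=> tI t1 tM.
have [c _ c0] : exists2 c, c \in [:: q1; qi; qj; qk] & avg t c != 0.
  apply/hasP; apply: contraT => /hasPn a0; have := quat_avg_sum tI t1.
  rewrite big_seq big1 => [|c /a0/negPn/eqP ->].
    move/(congr1 (@nda_re _ H)) => /=; rewrite /cd_re /= => /eqP.
    by rewrite mulr1 eq_sym (pnatr_eq0 R 4).
  by rewrite -(scale0r (0 : H)) nda_mulZl !scale0r.
have a0 : 0 < nda_inner (avg t c) (avg t c).
  rewrite lt0r nda_inner_ge0 andbT; apply/eqP => /nda_inner_eq0 a0.
  by rewrite a0 eqxx in c0.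
exists ((Num.sqrt (nda_inner (avg t c) (avg t c)))^-1 *: avg t c).
  rewrite nda_innerZl nda_innerZr mulrA -expr2 exprVn sqr_sqrtr ?ltW //.
  by rewrite mulVf // gt_eqF.
by move=> x; rewrite nda_mulZl nda_mulZr quat_avg_comm.
Qed.

(** For a unit b this is b^-1 x b, the orientation produced by multiplications on the right. *)
Let conjugation (b : H) x := nda_mul (nda_conj b) (nda_mul x b).

Lemma conjugation_linear b : linear (conjugation b).
Proof.
by move=> a x y; rewrite /conjugation nda_mulDl nda_mulZl nda_mulDr nda_mulZr.
Qed.

Lemma conjugation_inner b x y : nda_inner b b = 1 ->
  nda_inner (conjugation b x) (conjugation b y) = nda_inner x y.
Proof.
move=> b1; rewrite (nda_inner_mull quat_innerC) (nda_inner_mulr quat_innerC).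
by rewrite quat_inner_conj b1 !mul1r.
Qed.

(** Insert x x = 2 Re(x) x - |x|^2 into 1 + 2 x + x x. For a unit x the last term vanishes, and 1 +
    x is a square root of x up to scale. *)
Lemma quat_sqr1D x : nda_mul (q1 + x) (q1 + x) =
  (2 * (1 + nda_re x)) *: x + (1 - nda_inner x x) *: q1.
Proof.
by move: x => [[x1 x2] [x3 x4]];
  rewrite /nda_inner /= /cd_re /cd_mul /=; quat_eq.
Qed.

(* A unit quaternion other than -1 is the square of (1 + b) / |1 + b|, so its
   conjugation is the square of an isometry. *)
Lemma conjugation_special (b : H) (t : 'End(H)) : nda_inner b b = 1 ->
  (forall x, t x = conjugation b x) -> special_orthogonal H t.
Proof.
move=> b1 tE; have [bN1|bN1] := eqVneq b (- q1).
  have -> : t = \1%VF.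
    apply/lfunP => x; rewrite tE id_lfunE bN1 /conjugation.
    by move: x => [[x1 x2] [x3 x4]]; quat_eq.
  exact: special_orthogonal1.
have s0 : 0 < 1 + nda_re b.
  have n1 : nda_inner (q1 + b) (q1 + b) = 2 * (1 + nda_re b).
    rewrite !nda_innerDl !nda_innerDr b1 (quat_innerC q1 b) !quat_inner1.
    by rewrite (_ : nda_re q1 = 1) //; ring.
  have : 0 < nda_inner (q1 + b) (q1 + b).
    rewrite lt0r nda_inner_ge0 andbT; apply/eqP => /nda_inner_eq0/eqP.
    by rewrite addrC addr_eq0 (negbTE bN1).
  by rewrite n1 pmulr_rgt0.
pose s := (Num.sqrt (2 * (1 + nda_re b)))^-1; pose g := s *: (q1 + b).
have ss : s * s * (2 * (1 + nda_re b)) = 1.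
  rewrite -expr2 exprVn sqr_sqrtr ?mulr_ge0 ?ltW // mulVf // mulf_neq0 ?gt_eqF //.
have gg : nda_mul g g = b.
  by rewrite nda_mulZl nda_mulZr quat_sqr1D b1 subrr scale0r addr0 !scalerA ss scale1r.
have g1 : nda_inner g g = 1.
  have : nda_inner g g * nda_inner g g = 1 by rewrite -nda_normM gg.
  move/eqP; rewrite -expr2 sqrf_eq1 => /orP[/eqP //|/eqP gN].
  by have := nda_inner_ge0 g; rewrite gN ler0N1.
have [u uE] := linfun_exists (conjugation_linear g).
have -> : t = (u \o u)%VF.
  by apply/lfunP => x; rewrite comp_lfunE !uE tE /conjugation -gg quat_conjM !quat_mulA.
by apply: special_orthogonal_sqr => x y; rewrite !uE conjugation_inner.
Qed.

Lemma vmulA n (v : avec H n) x y : vmul (vmul v x) y = vmul v (nda_mul x y).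
Proof. by apply/ffunP => i; rewrite !ffunE quat_mulA. Qed.

Lemma orthogonal_rmul_quat n (b : H) :
  nda_inner b b = 1 -> orthogonal H n (rmul n b).
Proof.
move=> b1 v w; rewrite !rmulE /vinner; apply: eq_bigr => i _.
by rewrite !ffunE (nda_inner_mulr quat_innerC) b1 mul1r.
Qed.

Lemma twisted_quaternion n : (0 < n)%N ->
  twisted_isomorphisms H n = SpSp1_group R n.
Proof.
move=> n0; apply/seteqP; split=> f.
  move=> [fO [t [tI _] ft]].
  have t1 := twist1 n0 fO ft.
  have one0 : nda_one H != 0 by apply/eqP => -[/eqP]; rewrite oner_eq0.
  have [v [i fvi]] := orthogonal_neq0 n0 one0 fO.
  (* Computing f (v (x y)) = f ((v x) y) both ways gives c t(x y) = c t(x) t(y) at a nonzero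
     coordinate c. *)
  have tM x y : t (nda_mul x y) = nda_mul (t x) (t y).
    apply: (nda_mulI fvi); rewrite quat_mulA.
    have := congr1 (fun w : avec H n => w i) (ft v (nda_mul x y)).
    by rewrite -vmulA !ft !ffunE.
  have [b b1 bt] := quat_skolem_noether tI t1 tM.
  have bV : nda_mul b (nda_conj b) = q1 by rewrite quat_mul_conj b1 scale1r.
  have Vb : nda_mul (nda_conj b) b = q1 by rewrite quat_conj_mul b1 scale1r.
  have tE x : nda_mul (t x) (nda_conj b) = nda_mul (nda_conj b) x.
    by rewrite -[t x]nda_mul1l -/q1 -Vb -(quat_mulA _ b) -bt -!quat_mulA bV nda_mul1r.
  exists (rmul n (nda_conj b) \o f)%VF.
    split=> [|w x].
      apply: orthogonal_comp => //; apply: orthogonal_rmul_quat.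
      by rewrite quat_inner_conj.
    by rewrite !comp_lfunE !rmulE ft !vmulA tE.
  exists b; first exact/nda_norm_eq1.
  by move=> w; rewrite comp_lfunE rmulE vmulA Vb vmul1.
move=> [a [aO aL] [b /nda_norm_eq1 b1 fE]].
have [t tE] := linfun_exists (conjugation_linear b).
have -> : f = (rmul n b \o a)%VF by apply/lfunP => v; rewrite fE comp_lfunE rmulE.
split; first by apply: orthogonal_comp => //; apply: orthogonal_rmul_quat.
exists t; first exact: (conjugation_special b1).
(* Indeed alpha(v) x b = (alpha(v) b) (b^-1 x b). *)
move=> v x; rewrite !comp_lfunE !rmulE aL !vmulA tE /conjugation.
by rewrite !quat_mulA quat_mul_conj b1 scale1r nda_mul1l.
Qed.

End QuaternionCase.

(** * Clifford modules *)

Section CliffordModule.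
Variables (R : realType) (V : vectType R) (n : nat) (E : 'I_n -> 'End(V)).
Hypothesis E_sqr : forall i, (E i \o E i = - \1)%VF.
Hypothesis E_anti : forall i j, i != j -> (E i \o E j = - (E j \o E i))%VF.

(** [rho] and [spin] copy the shape of [spin_rep], for arbitrary anticommuting endomorphisms of
    square -1. *)
Let rho (S : {set 'I_n}) : 'End(V) :=
  \big[(@comp_lfun _ _ _ _) / \1%VF]_(i in S) E i.

Let spin (x : clifford R n) : 'End(V) := \sum_(S : {set 'I_n}) x S *: rho S.

(** E i moves right past the factors of smaller index, each costing a sign, to its own place in the
    increasing list. There it is inserted, or meets E i and cancels with E i E i = -1; hence the
    count of the j <= i, with i included. *)
Lemma clifford_module_seq (r : seq 'I_n) (i : 'I_n) (T : {set 'I_n}) :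
    pairwise (fun j k : 'I_n => (j < k)%N) r -> i \in r ->
  (E i \o \big[(@comp_lfun _ _ _ _) / \1]_(j <- r | j \in T) E j)%VF =
  (\prod_(j <- r | (j \in T) && (j <= i)%N) (-1)) *:
    \big[(@comp_lfun _ _ _ _) / \1%VF]_(j <- r | j \in symdiff [set i] T) E j.
Proof.
elim: r => [//|k r IHr]; rewrite pairwise_cons inE => /andP[/allP kr rP].
rewrite !big_cons in_symdiff !inE; have [ik|ik] := eqVneq i k.
  (* The list is increasing, so the tail has only indices above i: no further sign arises, and the
     symmetric difference leaves the tail unchanged. *)
  subst k => _; have -> : \prod_(j <- r | (j \in T) && (j <= i)%N) (-1) = 1 :> R.
    rewrite big_seq_cond big_pred0 // => j; apply/negbTE/negP => /and3P[jr _].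
    by rewrite leqNgt (kr _ jr).
  have -> : \big[(@comp_lfun _ _ _ _) / \1%VF]_(j <- r | j \in symdiff [set i] T) E j =
            \big[(@comp_lfun _ _ _ _) / \1%VF]_(j <- r | j \in T) E j.
    rewrite big_seq_cond [RHS]big_seq_cond; apply: eq_bigl => j.
    rewrite in_symdiff inE; case: (boolP (j \in r)) => //= jr; have := kr _ jr.
    by have [->|] := eqVneq j i; rewrite ?ltnn.
  rewrite leqnn andbT; case: (i \in T) => /=; last by rewrite scale1r.
  by rewrite comp_lfunA E_sqr comp_lfunNl comp_lfun1l mulr1 scaleN1r.
move=> /= ir; have {}IHr := IHr rP ir.
have ki : (k <= i)%N by apply/ltnW/kr.
rewrite ki andbT; case: (k \in T) => //=.
rewrite comp_lfunA E_anti // comp_lfunNl -comp_lfunA IHr -comp_lfunZr.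
by rewrite mulN1r scaleNr.
Qed.

Lemma clifford_module_mul i T :
  (E i \o rho T = cl_sign R [set i] T *: rho (symdiff [set i] T))%VF.
Proof.
rewrite /rho clifford_module_seq ?mem_index_enum //.
  by rewrite /cl_sign big_set1.
rewrite -sorted_pairwise; last by move=> j k l; apply: ltn_trans.
have := iota_ltn_sorted 0 n; rewrite -val_enum_ord sorted_map enumT.
by rewrite /index_enum unlock.
Qed.

Lemma clifford_module_linear : linear spin.
Proof.
move=> a x y; rewrite /spin scaler_sumr -big_split; apply: eq_bigr => S _.
by rewrite !ffunE scalerDl scalerA.
Qed.

Lemma clifford_module_basis S : spin (cl_basis R S) = rho S.
Proof.
rewrite /spin (bigD1 S) //= big1 => [|T TS].
  by rewrite ffunE eqxx scale1r addr0.
by rewrite ffunE (negbTE TS) scale0r.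
Qed.

(** This case of multiplicativity suffices, since the elements of the spin group are products of
    vectors. *)
Lemma clifford_module_vec v y :
  spin (cl_vec v * y) = ((\sum_i v 0 i *: E i) \o spin y)%VF.
Proof.
have [s sE] := linfun_exists clifford_module_linear.
rewrite -!sE /cl_vec mulr_suml linear_sum.
transitivity (\sum_i v 0 i *: (E i \o s y)%VF); last first.
  apply/lfunP => u; rewrite comp_lfunE !sum_lfunE; apply: eq_bigr => i _.
  by rewrite !scale_lfunE comp_lfunE.
apply: eq_bigr => i _; rewrite -scalerAl linearZ /=; congr (_ *: _).
rewrite {1}(cl_decomp y) mulr_sumr linear_sum.
apply/lfunP => u; rewrite sum_lfunE comp_lfunE sE /spin sum_lfunE linear_sum.
apply: eq_bigr => T _; rewrite -scalerAr linearZ /= !scale_lfunE linearZ /=.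
congr (_ *: _); rewrite -(comp_lfunE (E i)) clifford_module_mul sE.
have -> : cl_basis R [set i] * cl_basis R T =
          cl_sign R [set i] T *: cl_basis R (symdiff [set i] T).
  exact: cl_mul_basis.
by rewrite -sE linearZ /= sE clifford_module_basis.
Qed.

Lemma clifford_module_prod (s : seq 'rV[R]_n) :
  spin (\prod_(v <- s) cl_vec v) =
  \big[(@comp_lfun _ _ _ _) / \1%VF]_(v <- s) (\sum_i v 0 i *: E i).
Proof.
elim: s => [|v s IHs]; last by rewrite !big_cons clifford_module_vec IHs.
rewrite !big_nil -[1]/(cl_basis R finset.set0) clifford_module_basis.
by rewrite /rho big_set0.
Qed.

End CliffordModule.

(** * Octonions *)

Section OctonionAlgebra.
Variable R : realType.
Local Notation O := (octonion_alg R).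
Implicit Types x y z u : O.

Local Ltac oct_eq :=
  congr ((_, _), (_, _)); apply/eqP; rewrite eq_complex; apply/andP;
  split; apply/eqP => /=; ring.

Let q1 : O := nda_one O.

Lemma oct_innerC x y : nda_inner x y = nda_inner y x.
Proof.
by move: x y => [[[x1 x2] [x3 x4]] [[x5 x6] [x7 x8]]]
  [[[y1 y2] [y3 y4]] [[y5 y6] [y7 y8]]];
  rewrite /nda_inner /= /cd_re /cd_mul /= /cd_mul /=; ring.
Qed.

Lemma oct_inner1 x : nda_inner x (nda_one O) = nda_re x.
Proof.
by move: x => [[[x1 x2] [x3 x4]] [[x5 x6] [x7 x8]]];
  rewrite /nda_inner /= /cd_re /cd_mul /= /cd_mul /=; ring.
Qed.

Lemma oct_altl x y : nda_mul x (nda_mul x y) = nda_mul (nda_mul x x) y.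
Proof.
move: x y => [[[x1 x2] [x3 x4]] [[x5 x6] [x7 x8]]]
  [[[y1 y2] [y3 y4]] [[y5 y6] [y7 y8]]]; oct_eq.
Qed.

(** The linearised right alternative law, from which both the Clifford relations and the twisting by
    half turns follow. *)
Lemma oct_altr_polar x y z :
  nda_mul (nda_mul x y) z + nda_mul (nda_mul x z) y =
  nda_mul x (nda_mul y z + nda_mul z y).
Proof.
move: x y z => [[[x1 x2] [x3 x4]] [[x5 x6] [x7 x8]]]
  [[[y1 y2] [y3 y4]] [[y5 y6] [y7 y8]]] [[[z1 z2] [z3 z4]] [[z5 z6] [z7 z8]]]; oct_eq.
Qed.

Lemma oct_altr x y : nda_mul (nda_mul x y) y = nda_mul x (nda_mul y y).
Proof.
have := oct_altr_polar x y y; rewrite nda_mulDr -!mulr2n -!scaler_nat.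
by move/(scalerI _); apply; rewrite pnatr_eq0.
Qed.

(** Polarisation of x x = 2 Re(x) x - |x|^2; in particular orthogonal imaginary octonions
    anticommute. *)
Lemma oct_anticomm x u : nda_re u = 0 ->
  nda_mul x u + nda_mul u x = (2 * nda_re x) *: u - (2 * nda_inner x u) *: q1.
Proof.
move: x u => [[[x1 x2] [x3 x4]] [[x5 x6] [x7 x8]]]
  [[[y1 y2] [y3 y4]] [[y5 y6] [y7 y8]]].
rewrite /nda_inner /= /cd_re /cd_mul /= => ->; oct_eq.
Qed.

(** The bracket x - 2 Re(x) is -conj x. For a unit u, with u^-1 = -u, the negative of this formula
    is the half turn about u. *)
Lemma oct_sandwich x u : nda_re u = 0 -> nda_mul u (nda_mul x u) =
  nda_inner u u *: (x - (2 * nda_re x) *: q1) - (2 * nda_inner x u) *: u.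
Proof.
move: x u => [[[x1 x2] [x3 x4]] [[x5 x6] [x7 x8]]]
  [[[y1 y2] [y3 y4]] [[y5 y6] [y7 y8]]].
rewrite /nda_inner /= /cd_re /cd_mul /= => ->; oct_eq.
Qed.

Definition unit_imaginary u := nda_re u = 0 /\ nda_inner u u = 1.

Lemma unit_imaginaryN u : unit_imaginary u -> unit_imaginary (- u).
Proof.
move=> [u0 u1]; split; last by rewrite nda_innerNl nda_innerNr opprK.
by rewrite -oct_inner1 nda_innerNl oct_inner1 u0 oppr0.
Qed.

Lemma unit_imaginary_sqr u : unit_imaginary u -> nda_mul u u = - q1.
Proof.
move=> [u0 u1]; have := oct_anticomm u u0; rewrite u0 u1 mulr0 scale0r sub0r mulr1.
by rewrite -mulr2n -scaler_nat -scalerN; move/(scalerI _); apply; rewrite pnatr_eq0.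
Qed.

Lemma rmul_unit_imaginary_sqr x u :
  unit_imaginary u -> nda_mul (nda_mul x u) u = - x.
Proof. by move=> uP; rewrite oct_altr unit_imaginary_sqr // nda_mulNr nda_mul1r. Qed.

Lemma lmul_linear z : linear (fun x => nda_mul z x).
Proof. by move=> a x y; rewrite nda_mulDr nda_mulZr. Qed.

Lemma rmul_linear z : linear (fun x => nda_mul x z).
Proof. by move=> a x y; rewrite nda_mulDl nda_mulZl. Qed.

(** The root is (1 + u) / sqrt 2, because u u = -1 gives (1 + u)^2 = 2 u. *)
Lemma unit_imaginary_sqrt u : unit_imaginary u ->
  exists2 g : O, nda_inner g g = 1 & nda_mul g g = u.
Proof.
move=> uP; have [u0 u1] := uP; pose s : R := (Num.sqrt 2)^-1.
have ss : s * s * 2 = 1 by rewrite -expr2 exprVn sqr_sqrtr ?mulVf ?pnatr_eq0.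
exists (s *: (q1 + u)).
  rewrite nda_innerZl nda_innerZr !nda_innerDl !nda_innerDr u1 (oct_innerC q1 u).
  rewrite !oct_inner1 u0 (_ : nda_re q1 = 1) // addr0 add0r mulrA -[RHS]ss.
  by congr (_ * _).
rewrite nda_mulZl nda_mulZr scalerA nda_mulDl !nda_mulDr (unit_imaginary_sqr uP).
rewrite !nda_mul1l nda_mul1r addrC addrA subrK -mulr2n -scaler_nat scalerA.
by rewrite ss scale1r.
Qed.

(** By alternativity, multiplication by u = g g is the square of the isometry given by
    multiplication by g. *)
Lemma lmul_special u (f : 'End(O)) : unit_imaginary u ->
  (forall x, f x = nda_mul u x) -> special_orthogonal O f.
Proof.
move=> /unit_imaginary_sqrt[g g1 gu] fE; have [h hE] := linfun_exists (lmul_linear g).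
have -> : f = (h \o h)%VF by apply/lfunP => x; rewrite comp_lfunE !hE fE oct_altl gu.
apply: special_orthogonal_sqr => x y.
by rewrite !hE (nda_inner_mull oct_innerC) g1 mul1r.
Qed.

Lemma rmul_special u (f : 'End(O)) : unit_imaginary u ->
  (forall x, f x = nda_mul x u) -> special_orthogonal O f.
Proof.
move=> /unit_imaginary_sqrt[g g1 gu] fE; have [h hE] := linfun_exists (rmul_linear g).
have -> : f = (h \o h)%VF by apply/lfunP => x; rewrite comp_lfunE !hE fE oct_altr gu.
apply: special_orthogonal_sqr => x y.
by rewrite !hE (nda_inner_mulr oct_innerC) g1 mul1r.
Qed.

(* The rotation x |-> u x u^-1, which is the identity on span (1, u) and the
   opposite of the identity on its orthogonal complement. *)
Lemma half_turn u : unit_imaginary u -> exists2 t : 'End(O), special_orthogonal O t &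
  forall x, t x = (2 * nda_re x) *: q1 - x + (2 * nda_inner x u) *: u.
Proof.
move=> uP; have [u0 u1] := uP.
have [f fE] := linfun_exists (lmul_linear u).
have [g gE] := linfun_exists (rmul_linear (- u)).
exists (f \o g)%VF; last move=> x.
  apply: special_orthogonal_comp; first exact: lmul_special fE.
  exact: rmul_special (unit_imaginaryN uP) gE.
rewrite comp_lfunE fE gE !nda_mulNr oct_sandwich // u1 scale1r !opprB.
by rewrite addrC.
Qed.

(** Expanding t x and using (v u) u = -v turns the claim into (v x) u + (v u) x = v (x u + u x). *)
Lemma mul_half_turn u (t : 'End(O)) : unit_imaginary u ->
    (forall x, t x = (2 * nda_re x) *: q1 - x + (2 * nda_inner x u) *: u) ->
  forall v x, nda_mul (nda_mul v x) u = nda_mul (nda_mul v u) (t x).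
Proof.
move=> uP tE v x; have [u0 _] := uP.
rewrite tE !nda_mulDr !nda_mulZr nda_mul1r nda_mulNr rmul_unit_imaginary_sqr //.
apply/eqP; rewrite -subr_eq0 !opprD !opprK.
have := oct_altr_polar v x u; rewrite oct_anticomm // nda_mulDr nda_mulZr nda_mulNr.
rewrite nda_mulZr nda_mul1r => /eqP; rewrite -subr_eq0 => /eqP <-; apply/eqP.
by rewrite scalerN opprK opprB !addrA [LHS](ACl (1*3*4*2)).
Qed.
End OctonionAlgebra.

(** Makes [big_cat] available for composites of endomorphisms. *)
HB.instance Definition _ (K : fieldType) (V : vectType K) :=
  Monoid.isLaw.Build 'End(V) \1%VF (@comp_lfun K V V V)
    (@comp_lfunA K V V V V) (@comp_lfun1l K V V) (@comp_lfun1r K V V).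

(** * Octonions: Spin(7) and the twisted isomorphisms *)

Section OctonionCase.
Variable R : realType.
Local Notation O := (octonion_alg R).
Implicit Types x y z u : O.

Let q1 : O := nda_one O.
Let im (v : 'rV[R]_7) : O := im_octonion v.
Let e (i : 'I_7) : O := im (delta_mx 0 i).

Lemma im_octonion_linear : linear im.
Proof.
move=> a v w; rewrite /im /im_octonion !mxE; congr ((_, _), (_, _));
  by apply/eqP; rewrite eq_complex /= ?mulr0 ?addr0 !eqxx.
Qed.

Lemma im_octonionN v : im (- v) = - im v.
Proof. by have [h hE] := linfun_exists im_octonion_linear; rewrite -!hE linearN. Qed.

Lemma im_octonion_surj x : nda_re x = 0 -> exists v, x = im v.
Proof.
move: x => [[[x1 x2] [x3 x4]] [[x5 x6] [x7 x8]]]; rewrite /= /cd_re /= => ->.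
exists (\row_j nth 0 [:: x2; x3; x4; x5; x6; x7; x8] j).
by rewrite /im /im_octonion !mxE.
Qed.

Lemma re_im_octonion v : nda_re (im v) = 0.
Proof. by []. Qed.

Lemma sum_ord7 (V : nmodType) (F : 'I_7 -> V) :
  \sum_i F i = F 0 + (F 1 + (F 2 + (F 3 + (F 4 + (F 5 + F 6))))).
Proof.
rewrite !big_ord_recl big_ord0 addr0.
by do ![congr (_ + _)]; congr F; apply: val_inj.
Qed.

Lemma im_octonion_inner v w : nda_inner (im v) (im w) = \sum_i v 0 i * w 0 i.
Proof.
by rewrite sum_ord7 /nda_inner /im /im_octonion /= /cd_re /cd_mul /= /cd_mul /=; ring.
Qed.

Lemma im_octonion_basis v : im v = \sum_i v 0 i *: e i.
Proof.
have [f fE] := linfun_exists im_octonion_linear.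
rewrite -fE [in LHS](row_sum_delta v) linear_sum; apply: eq_bigr => i _.
by rewrite linearZ /= fE.
Qed.

Lemma basis_inner i j : nda_inner (e i) (e j) = (i == j)%:R.
Proof.
rewrite im_octonion_inner (bigD1 i) //= !mxE !eqxx mul1r big1 ?addr0 //.
by move=> k ki; rewrite !mxE (negbTE ki) mul0r.
Qed.

Lemma basis_unit i : unit_imaginary (e i).
Proof. by split; rewrite // basis_inner eqxx. Qed.

Lemma rmul_im_sum (v : 'rV[R]_7) :
  \sum_i v 0 i *: rmul 1 (e i) = rmul 1 (im v) :> 'End(avec O 1).
Proof.
apply/lfunP => w; rewrite sum_lfunE rmulE; apply/ffunP => j.
have [f fE] := linfun_exists (lmul_linear (w j)).
rewrite sum_ffunE ffunE -fE im_octonion_basis linear_sum; apply: eq_bigr => i _.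
by rewrite linearZ /= scale_lfunE rmulE !ffunE fE.
Qed.

Lemma rmul_sqr u : unit_imaginary u -> (rmul 1 u \o rmul 1 u = - \1)%VF.
Proof.
move=> uP; apply/lfunP => w; rewrite comp_lfunE opp_lfunE id_lfunE !rmulE.
by apply/ffunP => j; rewrite !ffunE rmul_unit_imaginary_sqr.
Qed.

Lemma rmul_anti i j : i != j ->
  (rmul 1 (e i) \o rmul 1 (e j) = - (rmul 1 (e j) \o rmul 1 (e i)))%VF.
Proof.
move=> ij; apply/lfunP => w; rewrite opp_lfunE !comp_lfunE !rmulE.
apply/ffunP => k; rewrite !ffunE; apply/eqP; rewrite -addr_eq0 oct_altr_polar.
rewrite oct_anticomm // re_im_octonion basis_inner [j == i]eq_sym (negbTE ij) !mulr0.
by rewrite !scale0r subr0 -(scale0r (0 : O)) nda_mulZr !scale0r.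
Qed.

(** Right multiplications by the imaginary basis units satisfy the Clifford relations, so the
    results on Clifford modules apply. *)
Lemma spin_rep_prod (s : seq 'rV[R]_7) :
  spin_rep (\prod_(v <- s) cl_vec v) =
  \big[(@comp_lfun _ _ _ _) / \1%VF]_(v <- s) rmul 1 (im v).
Proof.
rewrite /spin_rep (clifford_module_prod _ rmul_anti) => [|i]; last first.
  exact/rmul_sqr/basis_unit.
by apply: eq_bigr => v _; apply: rmul_im_sum.
Qed.

Lemma rmul_twisted u : unit_imaginary u -> twisted_isomorphisms O 1 (rmul 1 u).
Proof.
move=> uP; split.
  move=> v w; rewrite !rmulE /vinner; apply: eq_bigr => i _.
  by rewrite !ffunE (nda_inner_mulr (@oct_innerC R)) uP.2 mul1r.
have [t tS tE] := half_turn uP; exists t => // v x; rewrite !rmulE.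
by apply/ffunP => i; rewrite !ffunE (mul_half_turn uP tE).
Qed.

Let P (s : seq 'rV[R]_7) : 'End(avec O 1) :=
  \big[(@comp_lfun _ _ _ _) / \1%VF]_(v <- s) rmul 1 (im v).

Lemma rmul_prod_twisted s : (forall v, v \in s -> unit_imaginary (im v)) ->
  twisted_isomorphisms O 1 (P s).
Proof.
rewrite /P; elim: s => [|v s IHs] s1; first by rewrite big_nil; apply: twisted1.
rewrite big_cons; apply: twisted_comp; first exact/rmul_twisted/s1/mem_head.
by apply: IHs => w ws; apply: s1; rewrite inE ws orbT.
Qed.

Lemma Spin7_twisted f : Spin7_group R f -> twisted_isomorphisms O 1 f.
Proof.
move=> [_ [s [_ s1 ->]] <-]; rewrite spin_rep_prod.
apply: rmul_prod_twisted => v /s1 v1; split; first exact: re_im_octonion.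
by rewrite im_octonion_inner -[RHS]v1; apply: eq_bigr => i _; rewrite expr2.
Qed.

(* Every half turn used here flips the sign common to the images of the first k
   basis vectors, so that sign records the parity of the number of factors. *)
Lemma half_turn_reduction f (t : 'End(O)) k : (k <= 7)%N -> orthogonal O 1 f ->
    preserves_inner t -> (forall v x, f (vmul v x) = vmul (f v) (t x)) ->
  exists s g (r : 'End(O)), [/\ forall v, v \in s -> unit_imaginary (im v),
    g = (P s \o f)%VF, preserves_inner r,
    forall v x, g (vmul v x) = vmul (g v) (r x) &
    forall i : 'I_7, (i < k)%N -> r (e i) = (-1) ^+ size s *: e i].
Proof.
move=> k7 fO tI ft; elim: k k7 => [_|k IHk k7].
  exists [::], f, t; split=> //; by rewrite /P big_nil comp_lfun1l.
have [s [g [r [s1 gE rI gr re]]]] := IHk (ltnW k7).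
pose j := Ordinal k7; pose eps : R := (-1) ^+ size s.
have eps2 : eps * eps = 1 by rewrite -expr2 sqrr_sign.
have gO : orthogonal O 1 g.
  by rewrite gE; apply: orthogonal_comp => //; have [] := rmul_prod_twisted s1.
have r1 : r q1 = q1 by apply: (twist1 _ gO gr).
(* Since w and eps e_j have the same norm, 2 <w, d> = |d|^2, and the half turn about d sends w to -w
   + d = -eps e_j. *)
pose w := r (e j); pose d := w - eps *: e j.
(* If d = 0, the vector e_j already carries the common sign and no factor is added. *)
have [d0|d0] := eqVneq d 0.
  exists s, g, r; split=> // i; rewrite ltnS leq_eqVlt => /orP[/eqP ik|]; last exact: re.
  have -> : i = j by apply: val_inj.
  by apply/eqP; rewrite -subr_eq0; apply/eqP.
have ww : nda_inner w w = 1 by rewrite rI basis_inner eqxx.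
have rew : nda_re w = 0 by rewrite -oct_inner1 -/q1 -r1 rI oct_inner1.
have red : nda_re d = 0.
  by rewrite -oct_inner1 nda_innerDl nda_innerNl nda_innerZl !oct_inner1 rew mulr0 subr0.
have wd : 2 * nda_inner w d = nda_inner d d.
  rewrite /d !nda_innerDl !nda_innerDr !nda_innerNl !nda_innerNr.
  rewrite !nda_innerZl !nda_innerZr (oct_innerC (e j) w) ww basis_inner eqxx mulr1.
  by rewrite eps2; ring.
have dd : 0 < nda_inner d d.
  rewrite lt0r nda_inner_ge0 andbT; apply/eqP => /nda_inner_eq0 d0'.
  by rewrite d0' eqxx in d0.
pose c := (Num.sqrt (nda_inner d d))^-1.
have cc : c * c * nda_inner d d = 1.
  by rewrite -expr2 exprVn sqr_sqrtr ?ltW // mulVf // gt_eqF.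
have uP : unit_imaginary (c *: d).
  split; first by rewrite -oct_inner1 nda_innerZl oct_inner1 red mulr0.
  by rewrite nda_innerZl nda_innerZr mulrA.
have [h [hI _] hE] := half_turn uP.
have [v vE] := im_octonion_surj uP.1.
exists (v :: s), (rmul 1 (im v) \o g)%VF, (h \o r)%VF; split.
- by move=> w'; rewrite inE => /orP[/eqP ->|]; [rewrite -vE | apply: s1].
- by rewrite gE comp_lfunA /P big_cons.
- by move=> x y; rewrite !comp_lfunE hI rI.
- move=> y x; rewrite !comp_lfunE !rmulE gr.
  by apply/ffunP => i; rewrite !ffunE -vE (mul_half_turn uP hE).
- move=> i; rewrite ltnS leq_eqVlt comp_lfunE => /orP[/eqP ik|ik].
    have -> : i = j by apply: val_inj.
    rewrite -/w hE rew mulr0 scale0r sub0r nda_innerZr scalerA.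
    rewrite (_ : 2 * (c * nda_inner w d) * c = c * c * (2 * nda_inner w d)); last by ring.
    by rewrite wd cc scale1r /d addKr /= exprS mulN1r scaleNr.
  have ij : (i == j) = false by apply/eqP => ij; rewrite ij ltnn in ik.
  (* eps e_i = r e_i is orthogonal to w = r e_j, so e_i is orthogonal to d and the half turn negates
     it. *)
  have ed : nda_inner (e i) d = 0.
    rewrite /d nda_innerDr nda_innerNr nda_innerZr basis_inner.
    rewrite ij mulr0 subr0.
    apply/eqP; rewrite -[_ == 0](mulrI_eq0 _ (mulfI (x := eps) _)); last first.
      by apply/eqP => eps0; move: eps2; rewrite eps0 mul0r => /esym/eqP; rewrite oner_eq0.
    rewrite -nda_innerZl -(re i ik) rI basis_inner.
    by rewrite ij.
  rewrite re // linearZ /= hE nda_innerZr ed re_im_octonion !mulr0 !scale0r sub0r addr0.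
  by rewrite exprS mulN1r scaleNr scalerN.
Qed.

Lemma Spin7_prod s : ~~ odd (size s) ->
  (forall v, v \in s -> unit_imaginary (im v)) -> Spin7_group R (P s).
Proof.
move=> sE s1; exists (\prod_(v <- s) cl_vec v); last exact: spin_rep_prod.
exists s; split=> // v /s1[_]; rewrite im_octonion_inner => <-.
by apply: eq_bigr => i _; rewrite expr2.
Qed.

(** Right multiplication by -v undoes that by a unit imaginary v; this inverts the composite found
    by [half_turn_reduction]. *)
Lemma rmul_prod_rev (s : seq 'rV[R]_7) : (forall v, v \in s -> unit_imaginary (im v)) ->
  (P (rev (map -%R s)) \o P s)%VF = \1%VF.
Proof.
rewrite /P; elim: s => [|v s IHs] s1; first by rewrite /= big_nil comp_lfun1l.
rewrite map_cons rev_cons -cats1 big_cat big_cons big_seq1 /=.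
have -> : rmul 1 (im (- v)) = - rmul 1 (im v) :> 'End(avec O 1).
  apply/lfunP => w; rewrite opp_lfunE !rmulE im_octonionN; apply/ffunP => i.
  by rewrite !ffunE nda_mulNr.
rewrite comp_lfunA -(comp_lfunA _ (- _)%VF) comp_lfunNl rmul_sqr ?opprK; last first.
  by apply: s1; rewrite mem_head.
rewrite comp_lfun1r; apply: IHs => w ws; apply: s1; by rewrite inE ws orbT.
Qed.

Let oi : O := ((Complex 0 1, 0), 0).
Let oj : O := ((0, 1), 0).
Let ol : O := (0, (1, 0)).
Let ojl : O := (0, (0, 1)).

Let c5 (t : O) := complex.Re t.2.1.
Let c6 (t : O) := complex.Im t.2.1.
Let c7 (t : O) := complex.Re t.2.2.
Let c8 (t : O) := complex.Im t.2.2.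

(** In the coordinate equations below the two sides differ by twice a coordinate of a, up to
    sign. *)
Let half0 (x y z : R) : y = z -> y - z = 2 * x -> x = 0.
Proof. by move=> -> /eqP; rewrite subrr eq_sym mulf_eq0 pnatr_eq0 => /eqP. Qed.

(* Associating with two generators of a quaternion subalgebra forces membership in
   that subalgebra; the three subalgebras used here meet in the real line. *)
Lemma oct_nucleus a : (forall x y, nda_mul a (nda_mul x y) = nda_mul (nda_mul a x) y) ->
  a = nda_re a *: q1.
Proof.
move=> h; have h5 := congr1 c5 (h oi oj); have h6 := congr1 c6 (h oi oj).
have h7 := congr1 c7 (h oi oj); have h8 := congr1 c8 (h oi oj).
have h3 := congr1 c7 (h oi ol); have h4 := congr1 c8 (h oi ol).
have h2 := congr1 c8 (h oj ol).
move: a {h} h2 h3 h4 h5 h6 h7 h8 => [[[x1 x2] [x3 x4]] [[x5 x6] [x7 x8]]].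
rewrite /c5 /c6 /c7 /c8 /= /cd_mul /= /cd_mul /= => h2 h3 h4 h5 h6 h7 h8.
have -> : x5 = 0 by apply: half0 (esym h8) _; ring.
have -> : x6 = 0 by apply: half0 h7 _; ring.
have -> : x7 = 0 by apply: half0 (esym h6) _; ring.
have -> : x8 = 0 by apply: half0 h5 _; ring.
have -> : x3 = 0 by apply: half0 h4 _; ring.
have -> : x4 = 0 by apply: half0 (esym h3) _; ring.
have -> : x2 = 0 by apply: half0 (esym h2) _; ring.
rewrite /cd_re /=.
by congr ((_, _), (_, _)); apply/eqP; rewrite eq_complex /= ?mulr0 ?mulr1 !eqxx.
Qed.

Let c1 (t : O) := complex.Re t.1.1.
Let c2 (t : O) := complex.Im t.1.1.
Let c3 (t : O) := complex.Re t.1.2.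
Let c4 (t : O) := complex.Im t.1.2.

(** For orthogonal imaginary units x, y and a in the quaternion subalgebra they generate, the left
    side is -a (x y) and the right side a (x y), which forces a = 0 there. The subalgebras of the
    pairs (i, j), (i, l), (i, jl) together span the octonions. *)
Lemma oct_conj_nucleus a :
  (forall x y, nda_mul a (nda_conj (nda_mul x y)) =
    nda_mul (nda_mul a (nda_conj x)) (nda_conj y)) ->
  a = 0.
Proof.
move=> h; have h1 := congr1 c1 (h oi oj); have h2 := congr1 c2 (h oi oj).
have h3 := congr1 c3 (h oi oj); have h4 := congr1 c4 (h oi oj).
have h5 := congr1 c1 (h oi ol); have h6 := congr1 c2 (h oi ol).
have h7 := congr1 c1 (h oi ojl); have h8 := congr1 c2 (h oi ojl).
move: a {h} h1 h2 h3 h4 h5 h6 h7 h8 => [[[x1 x2] [x3 x4]] [[x5 x6] [x7 x8]]].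
rewrite /c1 /c2 /c3 /c4 /= /cd_mul /= /cd_mul /= => h1 h2 h3 h4 h5 h6 h7 h8.
have -> : x1 = 0 by apply: half0 (esym h4) _; ring.
have -> : x2 = 0 by apply: half0 h3 _; ring.
have -> : x3 = 0 by apply: half0 (esym h2) _; ring.
have -> : x4 = 0 by apply: half0 h1 _; ring.
have -> : x5 = 0 by apply: half0 (esym h6) _; ring.
have -> : x6 = 0 by apply: half0 h5 _; ring.
have -> : x7 = 0 by apply: half0 (esym h8) _; ring.
have -> : x8 = 0 by apply: half0 (esym h7) _; ring.
by [].
Qed.

Lemma twisted_Spin7 f : twisted_isomorphisms O 1 f -> Spin7_group R f.
Proof.
move=> [fO [t [tI _] ft]].
have [s [g [r [s1 gE rI gr re]]]] := half_turn_reduction (leqnn 7) fO tI ft.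
have gO : orthogonal O 1 g.
  by rewrite gE; apply: orthogonal_comp => //; have [] := rmul_prod_twisted s1.
(* As 1 generates O, the map g is determined by a = g 1 and r: it sends x to a (r x). *)
have r1 : r q1 = q1 by apply: (twist1 _ gO gr).
pose v0 : avec O 1 := [ffun=> q1]; pose a := g v0 ord0.
have gE0 x : g (vmul v0 x) ord0 = nda_mul a (r x) by rewrite gr ffunE.
have aM x y : nda_mul a (r (nda_mul x y)) = nda_mul (nda_mul a (r x)) (r y).
  have -> : nda_mul a (r (nda_mul x y)) = g (vmul (vmul v0 x) y) ord0.
    rewrite -gE0; congr (g _ _); apply/ffunP => i; rewrite !ffunE.
    by rewrite !nda_mul1l.
  by rewrite gr ffunE gE0.
have a1 : nda_inner a a = 1.
  have := gO v0 v0; rewrite /vinner !big_ord1 ffunE => ->.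
  by rewrite oct_inner1.
(* r fixes 1 and acts on all seven imaginary basis vectors by the same sign. *)
have rE x : r x = nda_re x *: q1 + (-1) ^+ size s *: (x - nda_re x *: q1).
  have x0 : nda_re (x - nda_re x *: q1) = 0.
    rewrite -oct_inner1 nda_innerDl nda_innerNl nda_innerZl !oct_inner1.
    by rewrite (_ : nda_re q1 = 1) // mulr1 subrr.
  have [v vE] := im_octonion_surj x0.
  rewrite -{1}[x](subrK (nda_re x *: q1)) addrC linearD linearZ /= r1.
  congr (_ + _); rewrite vE im_octonion_basis linear_sum scaler_sumr.
  by apply: eq_bigr => i _; rewrite linearZ /= re // !scalerA mulrC.
(* An odd number of factors makes r the conjugation, hence a = 0, against |a| = 1. *)
have sE : ~~ odd (size s).
  apply/negP => sodd; have rc x : r x = nda_conj x.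
    rewrite rE -signr_odd sodd expr1 scaleN1r opprB addrA -scalerDl -mulr2n -mulr_natl.
    by rewrite -(ndl_conjE (nda_laws O)) addrAC subrr add0r.
  have a0 : a = 0 by apply: oct_conj_nucleus => x y; rewrite -!rc.
  by move/eqP: a1; rewrite a0 nda_inner0l eq_sym oner_eq0.
have {}rE x : r x = x.
  by rewrite rE -signr_odd (negbTE sE) expr0 scale1r addrCA subrr addr0.
have aE : a = nda_re a *: q1.
  by apply: oct_nucleus => x y; rewrite -[in RHS](rE x) -[y in RHS]rE -aM rE.
have gZ : g = nda_re a *: \1%VF.
  apply/lfunP => w; rewrite scale_lfunE id_lfunE; apply/ffunP => i; rewrite !ffunE.
  have -> : w = vmul v0 (w ord0).
    by apply/ffunP => j; rewrite !ffunE nda_mul1l (ord1 j).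
  by rewrite (ord1 i) gE0 rE {1}aE nda_mulZl !ffunE !nda_mul1l.
(* Solve g = P s f for f; reversal and negation keep the number of factors even. *)
have fE : f = nda_re a *: P (rev (map -%R s)).
  rewrite -[f]comp_lfun1l -(rmul_prod_rev s1) -comp_lfunA -gE gZ.
  by rewrite -comp_lfunZr comp_lfun1r.
have s'1 v : v \in rev (map -%R s) -> unit_imaginary (im v).
  by rewrite mem_rev => /mapP[w /s1 wP ->]; rewrite im_octonionN; apply: unit_imaginaryN.
have s'E : ~~ odd (size (rev (map -%R s))) by rewrite size_rev size_map.
move: (rev _) s'1 s'E fE => s' s'1 s'E fE.
have : nda_re a * nda_re a = 1.
  by rewrite -a1 {3 4}aE nda_innerZl nda_innerZr oct_inner1 mulr1.
move/eqP; rewrite -expr2 sqrf_eq1 => /orP[] /eqP al; rewrite fE al.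
  by rewrite scale1r; apply: Spin7_prod.
(* The scalar -1 is right multiplication by a unit imaginary applied twice, so absorbing it
   preserves parity. *)
have -> : -1 *: P s' = P [:: delta_mx 0 0, delta_mx 0 0 & s'].
  rewrite {2}/P !big_cons comp_lfunA rmul_sqr; last exact: basis_unit.
  by rewrite comp_lfunNl comp_lfun1l scaleN1r.
apply: Spin7_prod; rewrite /= ?negbK // => v; rewrite !inE.
by move=> /or3P[/eqP ->|/eqP ->|/s'1 //]; apply: basis_unit.
Qed.

End OctonionCase.

Local Close Scope ring_scope.

Theorem proposition3 (R : realType) :
  [/\ (forall n : nat, (1 <= n)%N ->
         twisted_isomorphisms (real_alg R) n = O_group R n),
      (forall n : nat, (1 <= n)%N ->
         twisted_isomorphisms (complex_alg R) n = U_group R n),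
      (forall n : nat, (1 <= n)%N ->
         twisted_isomorphisms (quaternion_alg R) n = SpSp1_group R n) &
      twisted_isomorphisms (octonion_alg R) 1 = Spin7_group R].
Proof.
split=> [n _|n|n|]; first exact: twisted_real.
- exact: twisted_complex.
- exact: twisted_quaternion.
- apply/seteqP; split; [exact: twisted_Spin7 | exact: Spin7_twisted].
Qed.
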